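(* If a semigroup $X$ is ideally $\mathsf{T_{\!z}S}$-closed, then its ideal center $I\!Z(X)$ is projectively $\mathsf{T_{\!1}S}$-closed.
   Context: A topological semigroup is a topological space with a continuous associative operation. $\mathsf{T_{\!1}S}$: $T_1$ topological semigroups; $\mathsf{T_{\!z}S}$: Tychonoff zero-dimensional topological semigroups. For a class $\mathcal C$, a semigroup $S$ (with the discrete topology) is $\mathcal C$-closed if for every isomorphic topological embedding $h:S\to Y$ into $Y\in\mathcal C$, $h[S]$ is closed in $Y$; projectively $\mathcal C$-closed if every quotient semigroup $S/_\approx$ by a congruence is $\mathcal C$-closed; ideally $\mathcal C$-closed if for every ideal $I$ of $S$ (including $\emptyset$) the Rees quotient $S/I$ is $\mathcal C$-closed. $Z(X)=\{z\in X:\forall x\in X\ (xz=zx)\}$, $I\!Z(X)=\{z\in Z(X):zX\subseteq Z(X)\}$. *)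

(* Defs.v *)
From HB Require Import structures.
From mathcomp Require Import all_boot all_order all_algebra.
From mathcomp Require Import boolp classical_sets topology.
From mathcomp Require Import reals Rstruct Rstruct_topology.
Set Implicit Arguments. Unset Strict Implicit. Unset Printing Implicit Defensive.
Local Open Scope classical_set_scope.

Record semigroup := Semigroup {
  sg_car :> Type;
  sg_op : sg_car -> sg_car -> sg_car;
  sg_assoc : forall x y z, sg_op x (sg_op y z) = sg_op (sg_op x y) z }.

Definition is_topsemigroup (Y : topologicalType) (m : Y -> Y -> Y) : Prop :=
  (forall x y z, m x (m y z) = m (m x y) z) /\
  continuous (fun p : Y * Y => m p.1 p.2).

Definition tsg_class := forall Y : topologicalType, (Y -> Y -> Y) -> Prop.

Definition zero_dim_space (T : topologicalType) : Prop :=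
  forall (x : T) (U : set T), open U -> U x ->
    exists V : set T, [/\ clopen V, V x & V `<=` U].

Definition tychonoff_space (T : topologicalType) : Prop :=
  accessible_space T /\
  forall (a : T) (B : set T), closed B -> ~ B a ->
    exists f : T -> Rdefinitions.R,
      [/\ continuous f, f a = 0%R & forall b, B b -> f b = 1%R].

Definition T1S : tsg_class := fun Y m => is_topsemigroup m /\ accessible_space Y.
Definition TzS : tsg_class :=
  fun Y m => is_topsemigroup m /\ tychonoff_space Y /\ zero_dim_space Y.

(** isomorphic topological embedding of S (with the discrete topology) into Y:
    an injective homomorphism which is a homeomorphism onto its image, i.e.
    whose image is a discrete subspace of Y *)
Definition discrete_embedding (S : semigroup) (Y : topologicalType)
    (m : Y -> Y -> Y) (h : S -> Y) : Prop :=
  [/\ injective h,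
      (forall x y, h (sg_op x y) = m (h x) (h y)) &
      (forall s : S, exists U : set Y,
          [/\ open U, U (h s) & forall t, U (h t) -> t = s])].

Definition C_closed (C : tsg_class) (S : semigroup) : Prop :=
  forall (Y : topologicalType) (m : Y -> Y -> Y), C Y m ->
  forall h : S -> Y, discrete_embedding m h -> closed (range h).

Record congruence (S : semigroup) := Congruence {
  cg_rel :> S -> S -> Prop;
  cg_refl : forall x, cg_rel x x;
  cg_sym : forall x y, cg_rel x y -> cg_rel y x;
  cg_trans : forall x y z, cg_rel x y -> cg_rel y z -> cg_rel x z;
  cg_compat : forall a b c d, cg_rel a b -> cg_rel c d ->
                cg_rel (sg_op a c) (sg_op b d) }.

Section Quotient.
Variables (S : semigroup) (r : congruence S).

Record qcar := QCar { qset : set S; qsetP : exists x, qset = r x }.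

Definition qrep (A : qcar) : S := projT1 (cid (qsetP A)).
Lemma qrepP (A : qcar) : qset A = r (qrep A).
Proof. exact: (projT2 (cid (qsetP A))). Qed.

Definition qclass (x : S) : qcar := @QCar (r x) (ex_intro _ x erefl).

Definition qop (A B : qcar) : qcar := qclass (sg_op (qrep A) (qrep B)).

Lemma qcar_eq (A B : qcar) : qset A = qset B -> A = B.
Proof.
case: A B => [a pa] [b pb] /= E; move: pa pb; rewrite E => pa pb.
by rewrite (Prop_irrelevance pa pb).
Qed.

Lemma qclass_eq x y : r x y -> qclass x = qclass y.
Proof.
move=> xy.
have E : r x = r y.
  apply/funext => z; apply/propext; split => H.
  - exact: cg_trans (cg_sym xy) H.
  - exact: cg_trans xy H.
by apply: qcar_eq; rewrite /= E.
Qed.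

Lemma qrep_rel x : r (qrep (qclass x)) x.
Proof.
have E : r x = r (qrep (qclass x)) by exact: (qrepP (qclass x)).
have H : r x x := cg_refl r x.
by rewrite {1}E in H.
Qed.

Lemma qop_assoc A B C : qop A (qop B C) = qop (qop A B) C.
Proof.
rewrite /qop; apply: qclass_eq.
apply: (@cg_trans _ r _ (sg_op (qrep A) (sg_op (qrep B) (qrep C)))).
  by apply: cg_compat; [exact: cg_refl | exact: qrep_rel].
rewrite sg_assoc; apply: cg_sym.
by apply: cg_compat; [exact: qrep_rel | exact: cg_refl].
Qed.

Definition quotient_semigroup : semigroup := @Semigroup qcar qop qop_assoc.
End Quotient.

Definition projectively_C_closed (C : tsg_class) (S : semigroup) : Prop :=
  forall r : congruence S, C_closed C (quotient_semigroup r).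

Definition is_ideal (S : semigroup) (I : set S) : Prop :=
  forall x y, I y -> I (sg_op x y) /\ I (sg_op y x).

Section Rees.
Variables (S : semigroup) (I : set S) (HI : is_ideal I).

Definition rees_rel (x y : S) : Prop := x = y \/ (I x /\ I y).

Lemma rees_congruence_ax :
  [/\ (forall x, rees_rel x x), (forall x y, rees_rel x y -> rees_rel y x),
      (forall x y z, rees_rel x y -> rees_rel y z -> rees_rel x z) &
      (forall a b c d, rees_rel a b -> rees_rel c d ->
          rees_rel (sg_op a c) (sg_op b d))].
Proof.
split.
- by move=> x; left.
- by move=> x y [->|[]]; [left | right].
- move=> x y z [->|[Ix Iy]] // [<-|[_ Iz]]; by [right | right].
- move=> a b c d [->|[Ia Ib]] [->|[Ic Id]]; first by left.
  + by right; split; [exact: (@HI b c Ic).1 | exact: (@HI b d Id).1].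
  + by right; split; [exact: (@HI d a Ia).2 | exact: (@HI d b Ib).2].
  + by right; split; [exact: (@HI a c Ic).1 | exact: (@HI b d Id).1].
Qed.

Definition rees_congruence : congruence S :=
  let: And4 h1 h2 h3 h4 := rees_congruence_ax in
  @Congruence S rees_rel h1 h2 h3 h4.
End Rees.

(* Rees quotient S/I (for I empty this is isomorphic to S itself) *)
Definition rees_quotient (S : semigroup) (I : set S) (HI : is_ideal I) :=
  quotient_semigroup (rees_congruence HI).

Definition ideally_C_closed (C : tsg_class) (S : semigroup) : Prop :=
  forall (I : set S) (HI : is_ideal I), C_closed C (rees_quotient HI).

Definition center (X : semigroup) : set X :=
  [set z | forall x : X, sg_op x z = sg_op z x].

Definition ideal_center (X : semigroup) : set X :=
  [set z | @center X z /\ forall x : X, @center X (sg_op z x)].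

Section IdealCenter.
Variable X : semigroup.

Lemma ideal_center_mul (z w : X) :
  @ideal_center X z -> @ideal_center X w -> @ideal_center X (sg_op z w).
Proof.
move=> [_ Hz] _; split; first exact: Hz.
by move=> x; rewrite -sg_assoc; exact: Hz.
Qed.

Definition IZ_car := {z : X | @ideal_center X z}.

Definition IZ_op (a b : IZ_car) : IZ_car :=
  exist _ (sg_op (proj1_sig a) (proj1_sig b))
        (ideal_center_mul (proj2_sig a) (proj2_sig b)).

Lemma IZ_assoc a b c : IZ_op a (IZ_op b c) = IZ_op (IZ_op a b) c.
Proof.
apply: eq_sig => /=; first by rewrite sg_assoc.
move=> ?; exact: Prop_irrelevance.
Qed.

Definition ideal_center_semigroup : semigroup := @Semigroup IZ_car IZ_op IZ_assoc.
End IdealCenter.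

(* Main.v *)
(** A failure of TzS-closedness is witnessed by adding to the discrete semigroup
    [S] some filters as new points: the filter of a decreasing sequence of
    central subsets [F] with [F F] converging back to [F] (or to a point of [S]),
    together with all its translates [x F].  Such a space is zero-dimensional as
    soon as the filters have bases of sets that every other filter of the family
    decides, which is automatic for ultrafilters.

    Applied to the Rees quotients of [X], this shows that [IZ(X)] has no infinite
    chain of idempotents, is periodic, has subgroups of finite exponent, and has
    only finitely many elements outside its subgroups.  For the exponent one
    kills the largest ideal avoiding an idempotent [e]: the surviving elements
    [x] act on the subgroup at [e] through [x e], so only the group matters.

    Conversely let [phi] be a homomorphism from a commutative semigroup with
    these four properties onto a discrete subspace of a T1 topological
    semigroup, and [y] a limit point outside the image.  Take [e] maximal among
    the idempotents below (the idempotent powers of) all elements whose images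
    are near [y].  Bounded exponents make "some power of [v] is [phi e]" a
    closed condition failing at [y] and at [y y].  Multiplying together elements
    near [y] so that it keeps failing, the idempotent power of the product can be
    decreased strictly and forever, contradicting chain-finiteness. *)

Require Import Defs.
From HB Require Import structures.
From mathcomp Require Import all_boot boolp classical_sets cardinality topology.
From mathcomp Require Import ssralg Rstruct Rstruct_topology zify.
Set Implicit Arguments. Unset Strict Implicit. Unset Printing Implicit Defensive.
Local Open Scope classical_set_scope.

(** * Semigroups of filters *)

Definition filter_space (S : Type) (P : set (set_system S)) :=
  {G : set_system S | ProperFilter G /\ P G}.

Section FilterSpaceTopology.
Variables (S : Type) (P : set (set_system S)).
Local Notation T := (filter_space P).

HB.instance Definition _ := gen_eqMixin T.
HB.instance Definition _ := gen_choiceMixin T.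

Definition filter_space_open (V : set T) : Prop :=
  forall G, V G -> exists A, sval G A /\ forall G' : T, sval G' A -> V G'.

Let openT : filter_space_open setT.
Proof.
by move=> [G [PG ?]] _; exists setT; split => //=; exact: filterT.
Qed.

Let openI (U V : set T) :
  filter_space_open U -> filter_space_open V -> filter_space_open (U `&` V).
Proof.
move=> oU oV G [/oU[A [GA AU]] /oV[B [GB BV]]].
exists (A `&` B); split => [|G' GAB].
  by have := proj1 (proj2_sig G) => ?; exact: filterI.
by have := proj1 (proj2_sig G') => ?; split; [apply: AU|apply: BV];
  apply: filterS GAB => x [].
Qed.

Let open_bigU (I : Type) (f : I -> set T) :
  (forall i, filter_space_open (f i)) -> filter_space_open (\bigcup_i f i).
Proof.
move=> of_ G [i _ /of_[A [GA AU]]]; exists A; split => // G' /AU ?.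
by exists i.
Qed.

HB.instance Definition _ := isOpenTopological.Build T openT openI open_bigU.

Lemma filter_space_open_basic (A : set S) : open [set G : T | sval G A].
Proof. by move=> G /= GA; exists A. Qed.

(** For a decided [D] the complement of the basic open set of [D] is the basic open set of its
    complement, so both are clopen. *)
Definition decided (D : set S) := forall G, P G -> G D \/ G (~` D).

Lemma filter_space_clopen (D : set S) :
  decided D -> clopen [set G : T | sval G D].
Proof.
move=> dD; split; first exact: filter_space_open_basic.
rewrite (_ : [set _ | _] = ~` [set G : T | sval G (~` D)]).
  by apply: open_closedC; exact: filter_space_open_basic.
apply/seteqP; split => [[G [PG HG]] /= GD GnD|[G [PG HG]] /= nG].
  by have [x []] := filter_ex (filterI GD GnD).
by case: (dD G HG).
Qed.

Definition decidable_base :=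
  forall G A, P G -> G A -> exists D, [/\ D `<=` A, G D & decided D].

Hypothesis PD : decidable_base.

Lemma filter_space_zero_dim : zero_dim_space T.
Proof.
move=> [G [PG HG]] U oU /oU [A /= [GA AU]].
have [D [DA GD dD]] := PD HG GA.
exists [set G : T | sval G D]; split => //; first exact: filter_space_clopen.
move=> G' /= G'D; apply: AU; have := proj1 (proj2_sig G') => ?.
exact: filterS G'D.
Qed.

(** Comparable filters of the family coincide: if [G'] contains [G], every decided member of [G']
    lies in [G], since its complement cannot. *)
Lemma filter_space_accessible : accessible_space T.
Proof.
move=> [G [PG HG]] [G' [PG' HG']] /eqP GG'.
have [A [GA G'A]] : exists A, G A /\ ~ G' A.
  apply: contrapT => nA; apply: GG'.
  have GG' : G = G'.
    apply/seteqP; split => A GA; first by apply: contrapT => nG; apply: nA; exists A.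
    have [D [DA G'D dD]] := PD HG' GA.
    case: (dD _ HG) => [GD|GnD]; first exact: filterS GD.
    exfalso; apply: nA; exists (~` D); split => // G'nD.
    by have [x []] := filter_ex (filterI G'D G'nD).
  exact: eq_exist.
exists [set G : T | sval G A]; split; first exact: filter_space_open_basic.
  by rewrite inE.
by apply/negP; rewrite inE.
Qed.

End FilterSpaceTopology.

Lemma zero_dim_tychonoff (T : topologicalType) :
  accessible_space T -> zero_dim_space T -> tychonoff_space T.
Proof.
move=> T1 Z; split => // a B cB nBa.
have [V [[oV cV] Va VB]] := Z a (~` B) (closed_openC cB) nBa.
exists (fun x => if `[< V x >] then 0%R else 1%R); split.
- move=> x; have [Vx|nVx] := pselect (V x).
    apply: (@near_cst_continuous _ _ (0%R : Rdefinitions.R)).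
    have : \forall y \near x, V y by apply: open_nbhs_nbhs.
    by apply: filterS => y /asboolT ->.
  apply: (@near_cst_continuous _ _ (1%R : Rdefinitions.R)).
  have : \forall y \near x, (~` V) y.
    by apply: open_nbhs_nbhs; split => //; exact: closed_openC.
  by apply: filterS => y /asboolF ->.
- by rewrite asboolT.
- by move=> b Bb; rewrite asboolF // => /VB.
Qed.

Section NotClosed.
Variables (S : semigroup) (P : set (set_system S)).
Local Notation T := (filter_space P).

Hypothesis P_proper : forall G, P G -> ProperFilter G.
Hypothesis P_decided : decidable_base P.
Hypothesis P_principal : forall s : S, P (principal_filter s).
(** The filter generated by the products of members of [G] and [H] refines [K], so [K] can serve as
    the product of the two points. *)
Hypothesis P_mul : forall G H, P G -> P H -> exists2 K, P K & forall A, K A ->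
  exists B C, [/\ G B, H C & forall b c, B b -> C c -> A (sg_op b c)].

Let op_sig (G H : T) : {K : T | forall A, sval K A ->
  exists B C, [/\ sval G B, sval H C & forall b c, B b -> C c -> A (sg_op b c)]}.
Proof.
apply: cid.
have [K PK KP] := P_mul (proj2 (proj2_sig G)) (proj2 (proj2_sig H)).
by exists (exist _ K (conj (P_proper PK) PK)).
Qed.

Let op (G H : T) : T := sval (op_sig G H).

Let opP (G H : T) A : sval (op G H) A ->
  exists B C, [/\ sval G B, sval H C & forall b c, B b -> C c -> A (sg_op b c)].
Proof. exact: (proj2_sig (op_sig G H)). Qed.

Let meet (G : T) A B : sval G A -> sval G B -> exists2 x, A x & B x.
Proof.
move=> GA GB; have := proj1 (proj2_sig G) => ?.
by have [x [Ax Bx]] := filter_ex (filterI GA GB); exists x.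
Qed.

(** Decided bases separate distinct points by disjoint sets. Equations between products are checked
    this way, as [op] is controlled only through [opP]. *)
Let meet_eq (G H : T) :
  (forall A B, sval G A -> sval H B -> exists2 x, A x & B x) -> G = H.
Proof.
move=> GH; apply/eqP; apply: contrapT => /negP GneH.
have [U [oU]] := filter_space_accessible P_decided GneH.
rewrite !inE => UG nUH; have [A [GA AU]] := oU _ UG.
have [D [DA GD dD]] := P_decided (proj2 (proj2_sig G)) GA.
have pH := proj1 (proj2_sig H).
case: (dD _ (proj2 (proj2_sig H))) => HD.
  by apply: nUH; apply: AU; exact: filterS HD.
by have [x] := GH _ _ GD HD.
Qed.

Let op_topsemigroup : is_topsemigroup op.
Proof.
split=> [F G H|[F G] /= V]; last first.
  rewrite nbhsE /= => -[U [oU UFG] UV]; have [A [KA AU]] := oU _ UFG.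
  have [D [DA KD dD]] := P_decided (proj2 (proj2_sig (op F G))) KA.
  have [B [C [FB GC BC]]] := opP KD.
  exists ([set F' : T | sval F' B], [set G' : T | sval G' C]).
    by split; apply: open_nbhs_nbhs; split => //; exact: filter_space_open_basic.
  move=> [F' G'] /= [F'B G'C]; apply/UV/AU.
  have := proj1 (proj2_sig (op F' G')) => ?.
  (* The product of [F'] and [G'] contains [D] or its complement; the latter is refuted by a single
     product [b c] lying in both. *)
  case: (dD _ (proj2 (proj2_sig (op F' G')))) => [|KnD]; first exact: filterS.
  have [B' [C' [FB' GC' BC']]] := opP KnD.
  have [b Bb B'b] := meet F'B FB'; have [c Cc C'c] := meet G'C GC'.
  by exfalso; apply: BC' (BC _ _ Bb Cc).
apply: meet_eq => A A' /opP[B [C [FB KC BC]]] /opP[B' [C' [KB' HC' BC']]].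
have [D [E [GD HE DE]]] := opP KC; have [D' [E' [FD' GE' DE']]] := opP KB'.
have [f Bf D'f] := meet FB FD'; have [g Dg E'g] := meet GD GE'.
have [h Eh C'h] := meet HE HC'.
exists (sg_op f (sg_op g h)); first by apply: BC => //; exact: DE.
by rewrite sg_assoc; apply: BC' => //; exact: DE'.
Qed.

Let point (s : S) : T :=
  exist _ (principal_filter s) (conj (principal_filter_proper s) (P_principal s)).

Lemma filter_space_not_closed (F : set_system S) :
  P F -> (forall s, ~ F [set s]) -> ~ C_closed TzS S.
Proof.
move=> PF nF /(_ T op) cl.
have Tz : TzS op.
  split; first exact: op_topsemigroup.
  have T1 := filter_space_accessible P_decided.
  have Z := filter_space_zero_dim P_decided.
  by split => //; exact: zero_dim_tychonoff.
have emb : discrete_embedding op point.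
  split=> [s t [st]|s t|s].
  - have : principal_filter s [set t] by rewrite st; exact/principal_filterP.
    by move/principal_filterP.
  - apply: meet_eq => A B /principal_filterP Ast /opP[C [D [/= Cs Dt CD]]].
    exists (sg_op s t) => //; apply: CD; exact/principal_filterP.
  - exists [set G : T | sval G [set s]]; split.
    + exact: filter_space_open_basic.
    + by apply/principal_filterP.
    + by move=> t /principal_filterP.
have := cl Tz _ emb.
pose F' : T := exist _ F (conj (P_proper PF) PF).
have : ~ range point F'.
  move=> [s _ [sF]]; apply: (nF s); rewrite -sF; exact/principal_filterP.
move=> nr /(_ F') cF; apply/nr/cF => V.
rewrite nbhsE => -[U [oU UF] UV]; have [A [FA AU]] := oU _ UF.
have PrF := P_proper PF.
have [s As] := filter_ex FA; exists (point s); split; first by exists s.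
by apply/UV/AU/principal_filterP.
Qed.

End NotClosed.

(** * Translates of a filter of central elements *)

Section UnitAdjunction.
Variable S : semigroup.

(* [option S] stands for the semigroup [S] with an adjoined unit [None]. *)
Definition lmul1 (x : option S) (y : S) : S := if x is Some x then sg_op x y else y.
Definition rmul1 (y : S) (x : option S) : S := if x is Some x then sg_op y x else y.
Definition mul1 (x y : option S) : option S :=
  if y is Some y then Some (lmul1 x y) else x.

Lemma lmul1A x y z : lmul1 x (sg_op y z) = sg_op (lmul1 x y) z.
Proof. by case: x => //= x; rewrite sg_assoc. Qed.

Lemma rmul1A x y z : rmul1 (sg_op y z) x = sg_op y (rmul1 z x).
Proof. by case: x => //= x; rewrite sg_assoc. Qed.

Lemma lmul1_mul1 x y z : lmul1 (mul1 x y) z = lmul1 x (lmul1 y z).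
Proof. by case: y => //= y; rewrite lmul1A. Qed.

(** Centrality collects the filter variables on the right, so that the translates by [x] and [y]
    multiply into a translate by [x y]. *)
Lemma lmul1_shift x y z z' : @center S z ->
  sg_op (lmul1 x z) (lmul1 y z') = lmul1 (mul1 x y) (sg_op z z').
Proof.
move=> zc; case: y => [y|]; last by rewrite lmul1A.
by rewrite lmul1_mul1 -lmul1A /= !sg_assoc -zc.
Qed.

End UnitAdjunction.

Section Translates.
Variables (S : semigroup) (F : set_system S).

Definition translate (x : option S) : set_system S := [set A | F (lmul1 x @^-1` A)].

Definition translates : set (set_system S) :=
  [set G | (exists s, G = principal_filter s) \/ exists x, G = translate x].

Hypothesis F_proper : ProperFilter F.

Lemma translate_proper x : ProperFilter (translate x).
Proof. exact: fmap_proper_filter. Qed.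

Lemma decided_translates D :
  (forall x, translate x D \/ translate x (~` D)) -> decided translates D.
Proof.
move=> dD G [[s ->]|[x ->]] //.
by have [Ds|nDs] := pselect (D s); [left|right]; exact/principal_filterP.
Qed.

Lemma decidable_base_translates :
  (forall x s, translate x [set s] \/ translate x (~` [set s])) ->
  (forall x A, translate x A -> exists D, [/\ D `<=` A, translate x D &
     forall y, translate y D \/ translate y (~` D)]) ->
  decidable_base translates.
Proof.
move=> dec1 decx G A [[s ->]|[x ->]].
  move/principal_filterP => As; exists [set s]; split.
  - by move=> _ ->.
  - exact/principal_filterP.
  - by apply: decided_translates => x; exact: dec1.
move=> /decx[D [DA xD dD]]; exists D; split => //.
exact: decided_translates.
Qed.

(** The condition on [K] says that [F F] converges to a point of the space; the product of the
    translates by [x] and [y] is then the translate of [K] by [x y]. *)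
Lemma translates_not_closed :
  F (@center S) -> decidable_base translates ->
  (exists2 K, K = F \/ (exists s, K = principal_filter s) & forall A, K A ->
    exists2 B, F B & forall b c, B b -> B c -> A (sg_op b c)) ->
  (forall s, ~ F [set s]) -> ~ C_closed TzS S.
Proof.
move=> Fc dec [K KF FK] nF.
apply: (@filter_space_not_closed S translates _ dec _ _ F) => //.
- move=> G [[s ->]|[x ->]]; last exact: translate_proper.
  exact: principal_filter_proper.
- by move=> s; left; exists s.
- move=> _ _ [[s ->]|[x ->]] [[t ->]|[y ->]].
  + exists (principal_filter (sg_op s t)); first by left; exists (sg_op s t).
    move=> A /principal_filterP Ast; exists [set s], [set t].
    by split; [exact/principal_filterP| exact/principal_filterP|move=> _ _ -> ->].
  + exists (translate (mul1 (Some s) y)); first by right; exists (mul1 (Some s) y).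
    move=> A sA; exists [set s], [set u | A (sg_op s u)].
    split; [exact/principal_filterP| |by move=> _ u ->].
    by apply: (@filterS _ F _ _ _ _ sA) => u /=; rewrite lmul1_mul1.
  + exists (translate (mul1 x (Some t))); first by right; exists (mul1 x (Some t)).
    move=> A sA; exists [set u | A (sg_op u t)], [set t].
    split; [|exact/principal_filterP|by move=> u _ ? ->].
    apply: (@filterS _ F _ _ _ _ (@filterI _ F _ _ _ sA Fc)) => u /= [+ uc].
    by rewrite -!lmul1A -uc.
  + exists [set A | K (lmul1 (mul1 x y) @^-1` A)].
      case: KF => [->|[s ->]]; first by right; exists (mul1 x y).
      left; exists (lmul1 (mul1 x y) s).
      by apply/funext => A; apply/propext; split => /principal_filterP ?;
        apply/principal_filterP.
    move=> A /FK[B FB BA]; have FBc : F (B `&` @center S) by exact: filterI.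
    exists (lmul1 x @` (B `&` @center S)), (lmul1 y @` (B `&` @center S)); split.
    * by move: FBc; apply: (@filterS _ F _) => u Bu; exists u.
    * by move: FBc; apply: (@filterS _ F _) => u Bu; exists u.
    * move=> _ _ [b [Bb bc] <-] [c [Bc cc] <-]; rewrite lmul1_shift //.
      exact: BA.
- by right; exists None; rewrite /translate; apply/funext => A.
Qed.

Lemma ultra_translates_not_closed : UltraFilter F ->
  F (@center S) ->
  (exists2 K, K = F \/ (exists s, K = principal_filter s) & forall A, K A ->
    exists2 B, F B & forall b c, B b -> B c -> A (sg_op b c)) ->
  (forall s, ~ F [set s]) -> ~ C_closed TzS S.
Proof.
move=> UF Fc FK nF; apply: translates_not_closed => //.
have dec x A : translate x A \/ translate x (~` A).
  exact: (in_ultra_setVsetC (lmul1 x @^-1` A)).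
apply: decidable_base_translates => [x s|x A xA]; first exact: dec.
by exists A; split => // y; exact: dec.
Qed.

End Translates.

Lemma free_ultrafilter (T : Type) (C : set T) : infinite_set C ->
  exists F, [/\ UltraFilter F, F C & forall s, ~ F [set s]].
Proof.
move=> iC; pose F0 : set_system T := [set A | finite_set (C `\` A)].
have F0_proper : ProperFilter F0.
  split; first by rewrite /F0 /= setD0.
  split.
  - by rewrite /F0 /= setDT.
  - by move=> A B /= fA fB; rewrite /F0 /= setDIr finite_setU.
  - by move=> A B AB /=; apply: sub_finite_set; exact: setDS.
have [F [UF F0F]] := ultraFilterLemma F0_proper.
exists F; split => //; first by apply: F0F; rewrite /F0 /= setDv.
move=> s Fs; have : F (~` [set s]).
  by apply: F0F; rewrite /F0 /= setDE setCK; apply: finite_setIr.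
by move=> Fns; have [x []] := filter_ex (filterI Fs Fns).
Qed.

(** In such a set every product is one of its factors, so [F F] converges to [F] for a free
    ultrafilter [F] on [C]. *)
Lemma central_chain_finite (S : semigroup) (C : set S) :
  C_closed TzS S -> C `<=` @center S ->
  (forall x y, C x -> C y -> sg_op x y = x \/ sg_op x y = y) -> finite_set C.
Proof.
move=> cS Cc chain; apply: contrapT => /free_ultrafilter[F [UF FC nF]].
apply: (ultra_translates_not_closed _ UF) cS => //; first exact: filterS FC.
exists F; first by left.
move=> A FA; exists (A `&` C); first exact: filterI.
by move=> b c [Ab Cb] [Ac Cc']; have [->|->] := chain _ _ Cb Cc'.
Qed.

Lemma central_null_finite (S : semigroup) (C : set S) (s : S) :
  C_closed TzS S -> C `<=` @center S ->
  (forall x y, C x -> C y -> sg_op x y = s) -> finite_set C.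
Proof.
move=> cS Cc null; apply: contrapT => /free_ultrafilter[F [UF FC nF]].
apply: (ultra_translates_not_closed _ UF) cS => //; first exact: filterS FC.
exists (principal_filter s); first by right; exists s.
by move=> A /principal_filterP As; exists C => // b c Cb Cc'; rewrite null.
Qed.

(** * Powers and Rees quotients *)

Declare Scope sg_scope.
Delimit Scope sg_scope with sg.
Local Open Scope sg_scope.
Notation "x ** y" := (sg_op x y) (at level 40, left associativity) : sg_scope.

Section Powers.
Variable S : semigroup.
Implicit Types x y e : S.

(* [pow x n] is the usual power for [n > 0]; the junk value at [0] is [x]. *)
Definition pow x n := iter n.-1 (sg_op x) x.

Lemma powS x n : 0 < n -> pow x n.+1 = x ** pow x n.
Proof. by case: n. Qed.

Lemma powD x m n : 0 < m -> 0 < n -> pow x (m + n) = pow x m ** pow x n.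
Proof.
case: m => // m _; elim: m => [|m IH] n0 //; first by rewrite add1n powS.
by rewrite addSn powS ?addSn // -addSn IH // sg_assoc.
Qed.

Lemma powM x m n : 0 < m -> 0 < n -> pow (pow x m) n = pow x (m * n).
Proof.
move=> m0; case: n => // n _; elim: n => [|n IH]; first by rewrite muln1.
by rewrite powS // IH -powD ?muln_gt0 ?m0 // -mulnS.
Qed.

Lemma pow_comm x y n : x ** y = y ** x -> y ** pow x n = pow x n ** y.
Proof.
move=> xy; case: n => [|n] //.
elim: n => [|n IH] //.
by rewrite powS // sg_assoc -xy -!sg_assoc IH.
Qed.

Lemma pow_mul x y n : x ** y = y ** x -> pow (x ** y) n = pow x n ** pow y n.
Proof.
move=> xy; case: n => [|n] //; elim: n => [|n IH] //.
rewrite !(powS _ (ltn0Sn n)) IH -!sg_assoc; congr (_ ** _).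
by rewrite !sg_assoc (pow_comm _ xy).
Qed.

Lemma pow_idem e n : e ** e = e -> pow e n = e.
Proof. by move=> ee; case: n => // n; elim: n => // n IH; rewrite powS // IH. Qed.

Lemma center_pow x n : @center S x -> @center S (pow x n).
Proof. by move=> xc y; apply: pow_comm; rewrite xc. Qed.

Lemma center_mul x y : @center S x -> @center S y -> @center S (x ** y).
Proof. by move=> xc yc z; rewrite sg_assoc xc -sg_assoc yc sg_assoc. Qed.

Lemma ideal_center_mulr x y : @ideal_center S x -> @ideal_center S (x ** y).
Proof. by move=> [_ xc]; split => // z; rewrite -sg_assoc; exact: xc. Qed.

Lemma ideal_center_mull x y : @ideal_center S x -> @ideal_center S (y ** x).
Proof. by move=> xc; rewrite (proj1 xc); exact: ideal_center_mulr. Qed.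

Lemma ideal_center_pow x n : @ideal_center S x -> @ideal_center S (pow x n).
Proof.
by move=> xc; case: n => [|n] //; elim: n => // n IH; rewrite powS //;
  exact: ideal_center_mulr.
Qed.

Lemma pow_eq_idempotent x i j : 0 < i < j -> pow x i = pow x j ->
  exists2 k, 0 < k & pow x k ** pow x k = pow x k.
Proof.
move=> /andP[i0 ij] xij; pose p := j - i.
have p0 : 0 < p by rewrite subn_gt0.
have step n : i <= n -> pow x (n + p) = pow x n.
  rewrite leq_eqVlt => /predU1P[<-|ltin]; first by rewrite subnKC // ltnW.
  have d0 : 0 < n - i by rewrite subn_gt0.
  have -> : n + p = j + (n - i) by rewrite /p; lia.
  by rewrite powD // ?(leq_trans _ ij) // -xij -powD // subnKC // ltnW.
have steps n k : i <= n -> pow x (n + k * p) = pow x n.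
  move=> lein; elim: k => [|k IH]; first by rewrite addn0.
  by rewrite mulSn [p + _]addnC addnA step // (leq_trans lein) // leq_addr.
(* This exponent is a multiple of the period [p] and at least [i], so doubling it does not change
   the power. *)
exists (i * p); first by rewrite muln_gt0 i0.
by rewrite -powD ?muln_gt0 ?i0 // steps // leq_pmulr.
Qed.

End Powers.

Lemma pow_hom (S S' : semigroup) (f : S -> S') x n :
  (forall x y, f (x ** y) = f x ** f y) -> f (pow x n) = pow (f x) n.
Proof.
by move=> fM; case: n => // n; elim: n => // n IH; rewrite !(powS _ (ltn0Sn n)) fM IH.
Qed.

Section Quotients.
Variables (S : semigroup) (r : congruence S).

Lemma qclassM x y : qclass r (x ** y) = (qclass r x : quotient_semigroup r) ** qclass r y.
Proof. by apply/esym/qclass_eq; apply: cg_compat; exact: qrep_rel. Qed.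

Lemma qclass_inj x y : qclass r x = qclass r y -> r x y.
Proof.
move=> xy; apply: cg_trans (qrep_rel _ y); rewrite -xy.
exact/cg_sym/qrep_rel.
Qed.

Lemma qclass_qrep (a : qcar r) : qclass r (qrep a) = a.
Proof. by apply: qcar_eq; rewrite /= -qrepP. Qed.

End Quotients.

Section ReesQuotient.
Variables (X : semigroup) (I : set X) (HI : is_ideal I).

Definition rees_class (x : X) : rees_quotient HI := qclass (rees_congruence HI) x.

Lemma rees_classP x y : rees_class x = rees_class y <-> x = y \/ (I x /\ I y).
Proof.
have E : cg_rel (rees_congruence HI) = rees_rel I.
  by rewrite /rees_congruence; case: rees_congruence_ax.
split=> [/qclass_inj|xy]; first by rewrite E.
by apply: qclass_eq; rewrite E.
Qed.

Lemma rees_class_surj a : exists x, rees_class x = a.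
Proof. by exists (qrep a); exact: qclass_qrep. Qed.

Lemma rees_classM x y : rees_class (x ** y) = rees_class x ** rees_class y.
Proof. exact: qclassM. Qed.

Lemma rees_class_center x : @center X x -> @center _ (rees_class x).
Proof.
by move=> xc a; have [y <-] := rees_class_surj a; rewrite -!rees_classM xc.
Qed.

End ReesQuotient.

Section IdeallyClosed.
Variables (X : semigroup) (X_closed : ideally_C_closed TzS X).

Lemma ideally_closed_closed : C_closed TzS X.
Proof.
have HI : is_ideal (@set0 X) by [].
have inj x y : rees_class HI x = rees_class HI y -> x = y.
  by move/rees_classP => [|[]].
move=> Y m YC h [hinj hM hdisc].
pose h' (a : rees_quotient HI) := h (qrep a).
have h'E x : h' (rees_class HI x) = h x.
  by rewrite /h'; congr h; apply: inj; exact: qclass_qrep.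
suff -> : range h = range h'.
  apply: X_closed YC _ _; split.
  - move=> a b; have [x <-] := rees_class_surj a.
    by have [y <-] := rees_class_surj b; rewrite !h'E => /hinj ->.
  - move=> a b; have [x <-] := rees_class_surj a.
    by have [y <-] := rees_class_surj b; rewrite -rees_classM !h'E.
  - move=> a; have [x <-] := rees_class_surj a; have [U [oU Ux Uinj]] := hdisc x.
    exists U; split => //; first by rewrite h'E.
    by move=> b; have [y <-] := rees_class_surj b; rewrite h'E => /Uinj ->.
apply/seteqP; split => _ [x _ <-]; first by exists (rees_class HI x).
by have [y <-] := rees_class_surj x; rewrite h'E; exists y.
Qed.

(** All products of elements of [A] are zero in the Rees quotient by [J], and the quotient map is
    injective on [A] outside [J]. *)
Lemma null_mod_ideal_finite (J A : set X) : is_ideal J -> A `<=` @center X ->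
  (forall x y, A x -> A y -> J (x ** y)) -> finite_set (A `\` J).
Proof.
move=> HJ Ac AJ.
have inj : {in A `\` J &, injective (rees_class HJ)}.
  by move=> x y; rewrite !inE => -[_ nJx] _ /rees_classP [|[]].
have [[a [Aa _]]|/set0P/negP] := pselect (A `\` J !=set0); last first.
  by rewrite negbK => /eqP ->.
rewrite -(eq_finite_set (inj_card_eq inj)).
apply: (central_null_finite (s := rees_class HJ (a ** a)) (X_closed (HI := HJ))).
  by move=> _ [x [Ax _] <-]; apply/rees_class_center/Ac.
move=> _ _ [x [Ax _] <-] [y [Ay _] <-]; rewrite -rees_classM.
by apply/rees_classP; right; split; exact: AJ.
Qed.

End IdeallyClosed.

(** * Periodicity *)

(* If the powers of [z] are distinct, then the sets [{z^k : n! | k}] generate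
   a free filter of subsemigroups whose translates decide each other. *)
Lemma central_periodic (S : semigroup) (z : S) :
  C_closed TzS S -> @center S z -> exists i j, 0 < i < j /\ pow z i = pow z j.
Proof.
move=> cS zc; apply: contrapT => nper.
have zinj i j : 0 < i -> 0 < j -> pow z i = pow z j -> i = j.
  move=> i0 j0 zij; case: (ltngtP i j) => // ij; exfalso; apply: nper.
    by exists i, j; rewrite i0.
  by exists j, i; rewrite j0.
pose M n := [set k | 0 < k /\ n`! %| k].
have Mfact n : M n n`! by split; rewrite ?fact_gt0.
have Msub m n : m <= n -> M n `<=` M m.
  by move=> mn k [k0 nk]; split => //; apply: dvdn_trans nk; by rewrite (fact_split mn) dvdn_mulr.
pose F := filter_from setT (fun n => pow z @` M n).
have F_filter : Filter F.
  apply: filter_from_filter; first by exists 0.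
  move=> m n _ _; exists (maxn m n) => // _ [k Mk <-].
  by split; exists k => //; apply: Msub Mk; rewrite ?leq_maxl ?leq_maxr.
have F_proper : ProperFilter F.
  by apply: filter_from_proper => n _; exists (pow z n`!), n`!.
have FM n : F (pow z @` M n) by exists n.
pose xi x k := lmul1 x (pow z k).
have xiD x i j : 0 < i -> 0 < j -> xi x (i + j) = xi x i ** pow z j.
  by move=> i0 j0; rewrite /xi powD // lmul1A.
have xiF x A n : (forall k, M n k -> A (xi x k)) -> translate F x A.
  by move=> MA; exists n => // _ [k Mk <-]; exact: MA.
have xiM x A : translate F x A -> exists n, forall k, M n k -> A (xi x k).
  by move=> [n _ nA]; exists n => k Mk; apply: nA; exists k.
apply: (translates_not_closed F_proper) cS.
- by apply: filterS (FM 0) => _ [k _ <-]; exact: center_pow.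
- apply: decidable_base_translates => [x s|x A /xiM[n nA]].
    (* If [x z^k] repeats, the translate by [x] is principal; otherwise each [s] is hit by at most
       one exponent. *)
    have [[i [j [/andP[i0 ij] xij]]]|nxi] :=
        pselect (exists i j, 0 < i < j /\ xi x i = xi x j); last first.
      have [[k [k0 xk]]|nk] := pselect (exists k, 0 < k /\ xi x k = s).
        right; apply: (xiF _ _ k.+1) => l [l0 kl] /= xl; apply: nxi.
        exists k, l; rewrite k0 xk xl; split => //.
        apply: leq_trans (dvdn_leq l0 kl); exact: fact_geq.
      right; apply: (xiF _ _ 0) => l [l0 _] /= xl; apply: nk.
      by exists l.
    (* Positive multiples of [j!] are at least [i] and divisible by the period [j - i], and so is
       [i * (j - i)]; all these exponents give the value [c]. *)
    pose c := xi x (i * (j - i)); have p0 : 0 < j - i by rewrite subn_gt0.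
    have xc : translate F x [set c].
      apply: (xiF _ _ j) => l [l0 jl] /=.
      have il : i <= l.
        by apply: leq_trans (dvdn_leq l0 jl); apply: leq_trans (fact_geq j); exact: ltnW.
      have steps n k : i <= n -> xi x (n + k * (j - i)) = xi x n.
        move=> lein; elim: k => [|k <-]; first by rewrite addn0.
        have -> : n + k.+1 * (j - i) = j + (n + k * (j - i) - i) by lia.
        have [->|ne] := eqVneq (n + k * (j - i)) i; first by rewrite subnn addn0.
        have d0 : 0 < n + k * (j - i) - i by lia.
        rewrite xiD ?(leq_trans _ ij) // -xij -xiD // subnKC //; lia.
      have /dvdnP[l' El] : j - i %| l.
        by apply: dvdn_trans jl; apply: dvdn_fact; rewrite p0 leq_subr.
      have [le|/ltnW le] := leqP i l'.
        have -> : l = i * (j - i) + (l' - i) * (j - i) by rewrite -mulnDl subnKC.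
        by rewrite steps // leq_pmulr.
      have -> : c = xi x (l + (i - l') * (j - i)) by rewrite El -mulnDl subnKC.
      by rewrite steps.
    have [->|sc] := pselect (s = c); [by left|right].
    by apply: (@filterS _ F _ _ _ _ xc) => k /= -> /esym.
  exists (xi x @` M n); split.
  + by move=> _ [k Mk <-]; exact: nA.
  + by apply: (xiF _ _ n) => k Mk; exists k.
  (* One coincidence [x z^a = y z^b] with exponents divisible by [n!] propagates to all larger
     multiples [k] of [n!] on multiplying by [z^(k - b)]. *)
  + move=> y; have [[a [b [Ma Mb ab]]]|nab] :=
      pselect (exists a b, [/\ M n a, M n b & xi x a = xi y b]); last first.
      right; apply: (xiF _ _ n) => b Mb [a Ma ab]; apply: nab.
      by exists a, b.
    left; apply: (xiF _ _ (maxn n b)) => k Mk.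
    have [k0 nk] := Msub _ _ (leq_maxl n b) _ Mk.
    have bk : b <= k.
      apply: leq_trans (dvdn_leq k0 (proj2 Mk)).
      by apply: leq_trans (fact_geq _); exact: leq_maxr.
    move: bk; rewrite leq_eqVlt => /predU1P[<-|bk]; first by exists a.
    have [[a0 na] [b0 nb]] := (Ma, Mb); have d0 : 0 < k - b by rewrite subn_gt0.
    exists (a + (k - b)).
      by split; rewrite ?addn_gt0 ?a0 // dvdn_addr // dvdn_subr // ltnW.
    by rewrite xiD // ab -xiD // subnKC // ltnW.
- exists F; first by left.
  move=> A [n _ nA]; exists (pow z @` M n) => // _ _ [k [k0 nk] <-] [l [l0 nl] <-].
  apply: nA; exists (k + l); last by rewrite powD.
  by split; rewrite ?addn_gt0 ?k0 // dvdn_addr.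
- move=> s [n _ ns].
  have M2 : M n (n`! * 2) by split; rewrite ?muln_gt0 ?fact_gt0 ?dvdn_mulr.
  have e1 : pow z n`! = s by apply: ns; exists n`!.
  have e2 : pow z (n`! * 2) = s by apply: ns; exists (n`! * 2).
  have n0 := fact_gt0 n; have := zinj _ _ n0 (proj1 M2) (etrans e1 (esym e2)).
  by move: n0; lia.
Qed.

(** * Boundedness of subgroups *)

Section UnboundedTorsion.
Import GRing.Theory.
Local Open Scope ring_scope.
Variable G : zmodType.
Hypothesis torsion : forall g : G, exists2 k, (0 < k)%N & g *+ k = 0.
Hypothesis unbounded : forall N, (0 < N)%N -> exists g : G, g *+ N != 0.

Let period (g : G) : nat := s2val (cid2 (torsion g)).

Let period_gt0 g : (0 < period g)%N.
Proof. exact: (s2valP (cid2 (torsion g))). Qed.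

Let mul_period g : g *+ period g = 0.
Proof. exact: (s2valP' (cid2 (torsion g))). Qed.

Let large_sig M : {g : G | forall j, (0 < j <= M)%N -> g *+ j != 0}.
Proof.
apply: cid; have [g gM] := unbounded (fact_gt0 M); exists g => j jM.
by apply: contraNneq gM => gj; rewrite -(divnK (dvdn_fact jM)) mulnC mulrnA gj mul0rn.
Qed.

Let large M : G := sval (large_sig M).

Let largeP M j : (0 < j <= M)%N -> large M *+ j != 0.
Proof. exact: (svalP (large_sig M)). Qed.

Fixpoint annihilator (k : nat) : nat :=
  if k is k'.+1 then (annihilator k' * period (large (annihilator k' * 2 ^ k'.+2)))%N
  else 1.

(* [2 ^ k.+2] bounds the coefficients for which expansions in the [sparse k]
   are unique; [annihilator k] kills the subgroup generated by the earlier ones. *)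
Definition sparse k : G := large (annihilator k * 2 ^ k.+2).

Definition expansion (c : nat -> nat) K : G := \sum_(k < K) sparse k *+ c k.

Let annihilator_gt0 k : (0 < annihilator k)%N.
Proof. by elim: k => //= k IH; rewrite muln_gt0 IH period_gt0. Qed.

Let annihilatorP k K : (k < K)%N -> sparse k *+ annihilator K = 0.
Proof.
elim: K => // K IH; rewrite ltnS leq_eqVlt => /predU1P[->|/IH kK] /=.
  by rewrite mulnC mulrnA mul_period mul0rn.
by rewrite mulrnA kK mul0rn.
Qed.

(** Multiplying by [annihilator K] kills every term but the last, and [sparse K] has order too large
    for two distinct bounded coefficients to agree even then. Cancel the last term and induct. *)
Lemma expansion_inj c d K :
  (forall k, c k <= 2 ^ k.+2)%N -> (forall k, d k <= 2 ^ k.+2)%N ->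
  expansion c K = expansion d K -> forall k, (k < K)%N -> c k = d k.
Proof.
move=> cb db; elim: K => // K IH; rewrite /expansion !big_ord_recr /= => E.
have kill e : expansion e K *+ annihilator K = 0.
  rewrite /expansion -sumrMnl big1 // => k _.
  by rewrite -mulrnA mulnC mulrnA annihilatorP ?mul0rn.
have EK : sparse K *+ (c K * annihilator K) = sparse K *+ (d K * annihilator K).
  have := congr1 (fun x => x *+ annihilator K) E.
  by rewrite !mulrnDl -/(expansion c K) -/(expansion d K) !kill !add0r -!mulrnA.
have lt_absurd i j : (i < j)%N -> (j <= 2 ^ K.+2)%N ->
    sparse K *+ (i * annihilator K) = sparse K *+ (j * annihilator K) -> False.
  move=> ij jb /eqP; rewrite -subr_eq0 -opprB oppr_eq0 -mulrnBr ?leq_mul2r 1?ltnW ?orbT //.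
  rewrite -mulnBl; apply/negP; apply: largeP.
  rewrite muln_gt0 subn_gt0 ij annihilator_gt0 mulnC leq_mul2l.
  by rewrite (leq_trans (leq_subr _ _) jb) orbT.
have cdK : c K = d K.
  case: (ltngtP (c K) (d K)) => // lt; first by case: (lt_absurd _ _ lt (db K) EK).
  by case: (lt_absurd _ _ lt (cb K) (esym EK)).
move: E; rewrite cdK => /addIr /IH{}IH k.
by rewrite ltnS leq_eqVlt => /predU1P[->|/IH].
Qed.

Lemma expansionD c d K :
  expansion (fun k => c k + d k)%N K = expansion c K + expansion d K.
Proof. by rewrite /expansion -big_split; apply: eq_bigr => k _; rewrite mulrnDr. Qed.

Lemma expansion_widen c K L : (K <= L)%N -> (forall k, K <= k -> c k = 0)%N ->
  expansion c L = expansion c K.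
Proof.
move=> /subnKC <- c0; elim: (L - K)%N => [|n IH]; first by rewrite addn0.
by rewrite addnS /expansion big_ord_recr /= -/(expansion _ _) IH c0 ?leq_addr // addr0.
Qed.

(** The bound [2 ^ (k - n)] doubles when [n] drops by one, which leaves room for sums of two
    expansions. Excluding [c = 0] keeps 0 out of [expansions n], so that these sets can generate a
    free filter. *)
Definition coefficients n (c : nat -> nat) K : Prop :=
  [/\ forall k, (c k <= 2 ^ (k - n))%N, forall k, (k < n)%N -> c k = 0%N,
      forall k, (K <= k)%N -> c k = 0%N & exists k, c k != 0%N].

Definition expansions n : set G :=
  [set g | exists K c, coefficients n c K /\ g = expansion c K].

Let coef_le n c K k : coefficients n c K -> (c k <= 2 ^ k)%N.
Proof.
by case=> cb _ _ _; apply: leq_trans (cb k) _; rewrite leq_exp2l // leq_subr.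
Qed.

Let coef_le2 n c K k : coefficients n c K -> (c k <= 2 ^ k.+2)%N.
Proof.
by move=> /coef_le/leq_trans; apply; rewrite leq_exp2l // -addn2 leq_addr.
Qed.

Lemma expansions_neq0 n : expansions n !=set0.
Proof.
exists (expansion (fun k => (k == n) : nat) n.+1), n.+1, (fun k => (k == n) : nat).
split => //; split.
- by move=> k; case: eqP => //= _; rewrite expn_gt0.
- by move=> k; case: ltngtP.
- by move=> k; case: ltngtP.
- by exists n; rewrite eqxx.
Qed.

Lemma expansions_sub m n : (m <= n)%N -> expansions n `<=` expansions m.
Proof.
move=> mn _ [K [c [[cb cn cK c0] ->]]]; exists K, c; split => //; split => //.
  by move=> k; apply: leq_trans (cb k) _; rewrite leq_exp2l // leq_sub2l.
by move=> k km; apply: cn; exact: leq_trans mn.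
Qed.

Lemma expansionsD n g h :
  expansions n.+1 g -> expansions n.+1 h -> expansions n (g + h).
Proof.
move=> [K [c [[cb cn cK [k0 c0]] ->]]] [L [d [[db dn dL _] ->]]].
exists (maxn K L), (fun k => c k + d k)%N; split; last first.
  rewrite expansionD; congr (_ + _); apply/esym/expansion_widen => //.
    exact: leq_maxl.
  exact: leq_maxr.
split.
- move=> k; have [kn|nk] := leqP k n; first by rewrite cn // dn.
  apply: leq_trans (leq_add (cb k) (db k)) _.
  by rewrite addnn -mul2n -expnS leq_exp2l // -subSn.
- by move=> k kn; rewrite cn ?dn // ltnW.
- by move=> k; rewrite geq_max => /andP[? ?]; rewrite cK // dL.
- by exists k0; rewrite addn_eq0 negb_and c0.
Qed.

(** An expansion with support below [K] cannot, by uniqueness, also be a nonzero one supported from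
    [K] on. *)
Lemma expansions_free g : exists n, ~ expansions n g.
Proof.
apply: contrapT => all_g.
have {}all_g n : expansions n g by apply: contrapT => ?; apply: all_g; exists n.
have [K [c [cK gE]]] := all_g 0%N; have [L [d [dL hE]]] := all_g K.
have [_ _ cz [k c0]] := cK; have [_ dz dz' _] := dL.
have kK : (k < K)%N by rewrite ltnNge; apply: contra_neqN c0 => /cz.
have : c k = d k.
  apply: (@expansion_inj _ _ (maxn K L)).
  - by move=> ?; exact: coef_le2 cK.
  - by move=> ?; exact: coef_le2 dL.
  - by rewrite (expansion_widen (leq_maxl K L) cz) (expansion_widen (leq_maxr K L) dz') -gE -hE.
  - exact: leq_trans kK (leq_maxl _ _).
by rewrite dz // => ck; rewrite ck in c0.
Qed.

(** Comparing two meeting points, the second with [d'] supported from [M] on, uniqueness of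
    expansions gives [d <= c]. So [g] itself has the coefficients [c - d], supported below [M], and
    adding an expansion supported from [M] on stays in [expansions n]. *)
Lemma expansions_decided g n :
  (forall m, exists f, expansions m f /\ expansions n (g + f)) ->
  exists m, forall f, expansions m f -> expansions n (g + f).
Proof.
move=> meet; have [_ [[K [d [dK ->]]] [L [c [cL gE]]]]] := meet 0%N.
pose M := maxn n (maxn K L).
have [_ [[K' [d' [dK' ->]]] [L' [c' [cL' gE']]]]] := meet M.
have [_ _ dz _] := dK; have [cb cn cz _] := cL.
have [_ dn' dz' _] := dK'; have [_ _ cz' _] := cL'.
have KM : (K <= M)%N by rewrite /M; lia.
have LM : (L <= M)%N by rewrite /M; lia.
have nM : (n <= M)%N by rewrite /M; lia.
pose B := maxn M (maxn K' L').
have sumE k : (c k + d' k = c' k + d k)%N.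
  have [Bk|kB] := leqP B k.
    by rewrite /B in Bk; rewrite cz ?dz' ?cz' ?dz //; lia.
  apply: (@expansion_inj (fun k => c k + d' k)%N (fun k => c' k + d k)%N B) => //.
  - move=> i; apply: leq_trans (leq_add (coef_le i cL) (coef_le i dK')) _.
    by rewrite addnn -mul2n -expnS leq_exp2l.
  - move=> i; apply: leq_trans (leq_add (coef_le i cL') (coef_le i dK)) _.
    by rewrite addnn -mul2n -expnS leq_exp2l.
  rewrite !expansionD (expansion_widen _ cz) ?(expansion_widen _ dz') ?(expansion_widen _ cz')
    ?(expansion_widen _ dz); try by rewrite /B; lia.
  by rewrite -gE -gE' addrAC.
have dc k : (d k <= c k)%N.
  have [Mk|kM] := leqP M k; first by rewrite dz // (leq_trans KM).
  by have := sumE k; rewrite dn' // addn0 => ->; exact: leq_addl.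
pose v k := (c k - d k)%N.
have vE : g = expansion v M.
  have := gE; rewrite -(expansion_widen KM dz) -(expansion_widen LM cz).
  have -> : expansion c M = expansion v M + expansion d M.
    by rewrite -expansionD; apply: eq_bigr => k _; rewrite subnK.
  exact: addIr.
exists M => _ [K1 [e [[eb en ez [k0 e0]] ->]]].
have vz k : (M <= k)%N -> v k = 0%N by move=> Mk; rewrite /v cz ?(leq_trans LM).
exists (maxn M K1), (fun k => v k + e k)%N; split; last first.
  by rewrite expansionD vE !(expansion_widen _ vz) ?leq_maxl // (expansion_widen _ ez) ?leq_maxr.
split.
- move=> k; have [Mk|kM] := leqP M k.
    rewrite vz // add0n (leq_trans (eb k)) // leq_exp2l //; exact: leq_sub2l.
  by rewrite en // addn0 (leq_trans (leq_subr _ _)).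
- by move=> k kn; rewrite /v cn // en // (leq_trans kn).
- by move=> k; rewrite geq_max => /andP[? ?]; rewrite vz // ez.
- by exists k0; rewrite addn_eq0 negb_and e0 orbT.
Qed.

End UnboundedTorsion.

Lemma pow_mul_fix (S : semigroup) (x e : S) n : x ** e = x -> pow x n ** e = pow x n.
Proof.
by move=> xe; case: n => // n; elim: n => // n IH; rewrite powS // -sg_assoc IH.
Qed.

(* The largest ideal disjoint from [A]. *)
Definition avoiding (X : semigroup) (A : set X) : set X :=
  [set x | forall p q, ~ A (rmul1 (lmul1 p x) q)].

Lemma avoiding_ideal (X : semigroup) (A : set X) : is_ideal (avoiding A).
Proof.
move=> x y Iy; split => p q.
  by have := Iy (mul1 p (Some x)) q; rewrite lmul1_mul1.
by have := Iy p (mul1 (Some x) q); case: q => [q|] /=; rewrite ?lmul1A ?sg_assoc.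
Qed.

(** For an idempotent [e] of the ideal center this is the torsion part of the group of units of
    [e IZ(X)]. *)
Definition subgroup_at (X : semigroup) (e : X) : set X :=
  [set h | [/\ @ideal_center X h, h ** e = h & exists2 k, 0 < k & pow h k = e]].

Section SubgroupAt.
Variables (X : semigroup) (e : X).
Hypotheses (eI : @ideal_center X e) (ee : e ** e = e).

Lemma subgroup_at_id : subgroup_at e e.
Proof. by split => //; exists 1. Qed.

Lemma subgroup_at_mul x y : subgroup_at e x -> subgroup_at e y -> subgroup_at e (x ** y).
Proof.
move=> [xI xe [k k0 xk]] [yI ye [l l0 yl]]; split.
- exact: ideal_center_mul.
- by rewrite -sg_assoc ye.
- exists (k * l); first by rewrite muln_gt0 k0.
  rewrite pow_mul; last by rewrite (proj1 yI).
  by rewrite -powM // xk mulnC -powM // yl !pow_idem.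
Qed.

Lemma subgroup_at_inv x : subgroup_at e x -> exists2 y, subgroup_at e y & y ** x = e.
Proof.
move=> [xI xe [k k0 xk]].
(* The inverse is taken as [x^(2k-1)], since [x^(k-1)] would meet the junk value of [pow] when
   [k = 1]. *)
have kk : 0 < k.*2.-1 by lia.
exists (pow x k.*2.-1).
  split; first exact: ideal_center_pow.
    exact: pow_mul_fix.
  exists k => //; rewrite powM // mulnC -powM // xk pow_idem //.
have -> : pow x k.*2.-1 ** x = pow x (k.*2.-1 + 1) by rewrite powD.
have -> : k.*2.-1 + 1 = k * 2 by lia.
by rewrite -powM // xk pow_idem.
Qed.

End SubgroupAt.

Section SubgroupZmodule.
Variables (X : semigroup) (e : {e : X | @ideal_center X e /\ e ** e = e}).

Definition subgroup_type := {h : X | subgroup_at (sval e) h}.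

HB.instance Definition _ := gen_eqMixin subgroup_type.
HB.instance Definition _ := gen_choiceMixin subgroup_type.

Let eI := proj1 (proj2_sig e).
Let ee := proj2 (proj2_sig e).

Definition subgroup_add (g h : subgroup_type) : subgroup_type :=
  exist _ _ (subgroup_at_mul ee (proj2_sig g) (proj2_sig h)).

Definition subgroup_zero : subgroup_type := exist _ _ (subgroup_at_id eI ee).

Let opp_sig (g : subgroup_type) :
  {h : subgroup_type | sval h ** sval g = sval e}.
Proof.
apply: cid; have [h hP hg] := subgroup_at_inv ee (proj2_sig g).
by exists (exist _ h hP).
Qed.

Definition subgroup_opp g := sval (opp_sig g).

Let addA : associative subgroup_add.
Proof. by move=> g h k; apply: eq_exist; rewrite /= sg_assoc. Qed.

Let addC : commutative subgroup_add.
Proof.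
by move=> g [h hP]; apply: eq_exist; rewrite /=; have [[hc _] _ _] := hP.
Qed.

Let add0 : left_id subgroup_zero subgroup_add.
Proof.
move=> [h hP]; apply: eq_exist; rewrite /=.
by have [[hc _] he _] := hP; rewrite hc.
Qed.

Let addN : left_inverse subgroup_zero subgroup_opp subgroup_add.
Proof. by move=> g; apply: eq_exist; exact: (proj2_sig (opp_sig g)). Qed.

HB.instance Definition _ := GRing.isZmodule.Build subgroup_type addA addC add0 addN.

Lemma subgroup_mulrn (g : subgroup_type) n : 0 < n ->
  sval (g *+ n)%R = pow (sval g) n.
Proof.
case: n => // n _; elim: n => [|n IH] //.
by rewrite powS // -IH GRing.mulrS.
Qed.

End SubgroupZmodule.

Section IdeallyClosedGroups.
Variables (X : semigroup) (X_closed : ideally_C_closed TzS X).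

Lemma ideally_closed_periodic z : @center X z ->
  exists2 k, 0 < k & pow z k ** pow z k = pow z k.
Proof.
move=> zc; have XC := ideally_closed_closed X_closed.
have [i [j [ij zij]]] := central_periodic XC zc.
exact: pow_eq_idempotent zij.
Qed.

Variable e : X.
Hypotheses (eI : @ideal_center X e) (ee : e ** e = e).

(** For an idempotent power [f = h^k], the equality [e = f h'^k] gives [f e = e], while [h e = h]
    gives [f e = f]. *)
Lemma subgroup_at_unit h h' : @ideal_center X h -> @center X h' ->
  h ** e = h -> h ** h' = e -> subgroup_at e h.
Proof.
move=> hI hc' he hh'; split => //; have [k k0 fk] := ideally_closed_periodic (proj1 hI).
exists k => //; set f := pow h k in fk *.
have fe : f ** e = f by exact: pow_mul_fix.
have fh' : f ** pow h' k = e.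
  by rewrite /f -pow_mul ?hh' ?pow_idem // -hc' hh'.
by rewrite -fh' -fk -sg_assoc fh' fe.
Qed.

(** Outside the ideal some [p x q] equals [e]; multiplied by [e], all factors become central, and
    [x e] is invertible with respect to [e]. *)
Lemma avoiding_subgroup x : ~ avoiding [set e] x -> subgroup_at e (x ** e).
Proof.
move=> nI.
have [p [q pxq]] : exists p q, rmul1 (lmul1 p x) q = e.
  by apply: contrapT => n; apply: nI => p q /= pxq; apply: n; exists p, q.
have cen y : @center X (y ** e) by exact: (proj1 (ideal_center_mull y eI)).
have eye y : e ** (y ** e) = y ** e by rewrite -(proj1 eI) -sg_assoc ee.
have lmulc p' y : lmul1 p' y ** e = lmul1 p' e ** (y ** e).
  by case: p' => [p'|] /=; rewrite -?sg_assoc eye.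
have rmulc y q' : rmul1 y q' ** e = (y ** e) ** rmul1 e q'.
  case: q' => [q'|] /=; rewrite -!sg_assoc ?ee //.
  by rewrite (sg_assoc e e) ee (proj1 eI).
apply: (@subgroup_at_unit _ (lmul1 p e ** rmul1 e q)).
- exact: ideal_center_mull.
- apply: center_mul; first by case: (p) => [p'|]; [exact: cen|exact: (proj1 eI)].
  by case: (q) => [q'|] /=; rewrite -?(proj1 eI); [exact: cen|exact: (proj1 eI)].
- by rewrite -sg_assoc ee.
- by rewrite sg_assoc -(cen x) -lmulc -rmulc pxq ee.
Qed.

Lemma subgroup_avoiding h : subgroup_at e h -> ~ avoiding [set e] h.
Proof.
move=> /(subgroup_at_inv ee)[h' _ hh'] /(_ (Some h') None); exact.
Qed.

(** For an infinite exponent the sets [expansions n] of the group would generate a free filter whose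
    translates in the Rees quotient by [avoiding [set e]] decide each other, against closedness of
    that quotient. *)
Theorem subgroup_at_bounded : exists2 N, 0 < N & forall h, subgroup_at e h -> pow h N = e.
Proof.
apply: contrapT => nB; pose G : zmodType := subgroup_type (exist _ e (conj eI ee)).
have torsion (g : G) : exists2 k, 0 < k & (g *+ k)%R = 0%R.
  have [_ _ [k k0 gk]] := proj2_sig g; exists k => //.
  by apply: eq_sig_hprop => [? ? ?|]; [exact: Prop_irrelevance|rewrite subgroup_mulrn].
have unbounded N : 0 < N -> exists g : G, (g *+ N)%R != 0%R.
  move=> N0; apply: contrapT => ng; apply: nB; exists N => // h hP.
  apply: contrapT => hN; apply: ng; exists (exist _ h hP); apply/eqP.
  by move=> /(congr1 sval); rewrite subgroup_mulrn.
pose E := @expansions G torsion unbounded.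
pose HI := avoiding_ideal (A := [set e]).
pose phi (g : G) : rees_quotient HI := rees_class HI (sval g).
have phi_inj : injective phi.
  move=> g h /rees_classP[gh|[]]; last by move/(subgroup_avoiding (proj2_sig g)).
  by apply: eq_sig_hprop => [? ? ?|//]; exact: Prop_irrelevance.
(* A killed [x] is constant on the group; any other [x] acts as the group translation by [x e],
   because [x h = (x e) h]. *)
have act x : (exists s, forall h, lmul1 x (phi h) = s) \/
             (exists g, forall h, lmul1 x (phi h) = phi (g + h)%R).
  case: x => [x|]; last by right; exists 0%R => h; rewrite GRing.add0r.
  have [{}x <-] := rees_class_surj x.
  have xE h : lmul1 (Some (rees_class HI x)) (phi h) = rees_class HI (x ** sval h).
    by rewrite rees_classM.
  have [Ix|nIx] := pselect (avoiding [set e] x).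
    left; exists (rees_class HI x) => h; rewrite xE.
    by apply/rees_classP; right; split => //; exact: (HI _ _ Ix).2.
  right; exists (exist _ _ (avoiding_subgroup nIx)) => h; rewrite xE /phi.
  have [[hc _] he _] := proj2_sig h.
  congr (rees_class HI _); change (x ** sval h = x ** e ** sval h).
  by rewrite -sg_assoc (hc e) he.
pose F := filter_from setT (fun n => phi @` E n).
have F_filter : Filter F.
  apply: filter_from_filter; first by exists 0.
  move=> m n _ _; exists (maxn m n) => // _ [g Eg <-].
  by split; exists g => //; apply: expansions_sub Eg; rewrite ?leq_maxl ?leq_maxr.
have F_proper : ProperFilter F.
  apply: filter_from_proper => n _.
  by have [g Eg] := expansions_neq0 torsion unbounded n; exists (phi g), g.
have FT x A n : (forall g, E n g -> A (lmul1 x (phi g))) -> translate F x A.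
  by move=> EA; exists n => // _ [g Eg <-]; exact: EA.
have TF x A : translate F x A -> exists n, forall g, E n g -> A (lmul1 x (phi g)).
  by move=> [n _ nA]; exists n => g Eg; apply: nA; exists g.
have const x s A : (forall h, lmul1 x (phi h) = s) ->
    translate F x A \/ translate F x (~` A).
  move=> xs; have [As|nAs] := pselect (A s); [left|right];
  by apply: (FT _ _ 0) => g _; rewrite xs.
have dec1 x s : translate F x [set s] \/ translate F x (~` [set s]).
  have [[t xt]|[g xg]] := act x; first exact: const xt.
  right; have [[h hs]|nh] := pselect (exists h, phi h = s).
    have [n nE] := expansions_free torsion unbounded (h - g)%R.
    apply: (FT _ _ n) => f Ef; rewrite xg -hs => /phi_inj gf; apply: nE.
    by rewrite -gf GRing.addrAC GRing.subrr GRing.add0r.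
  by apply: (FT _ _ 0) => f _; rewrite xg => gs; apply: nh; exists (g + f)%R.
have XC := X_closed (HI := HI).
apply: (translates_not_closed F_proper) XC.
- apply: filterS (_ : F (phi @` E 0)); last by exists 0.
  by move=> _ [h _ <-]; apply: rees_class_center; have [[]] := proj2_sig h.
- apply: decidable_base_translates => // x A /TF[n nA].
  have [[s xs]|[g xg]] := act x.
    exists [set s]; split.
    + move=> _ ->; have [h Eh] := expansions_neq0 torsion unbounded n.
      by rewrite -(xs h); exact: nA.
    + by apply: (FT _ _ 0) => h _; rewrite xs.
    + by move=> y; exact: dec1.
  exists ((fun h => lmul1 x (phi h)) @` E n); split.
  + by move=> _ [h Eh <-]; exact: nA.
  + by apply: (FT _ _ n) => h Eh; exists h.
  + move=> y; have [[s ys]|[g' yg]] := act y; first exact: const ys.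
    (* Either the shift of every [E m] by [g' - g] meets [E n], and [expansions_decided] yields an
       inclusion, or some shift misses [E n] altogether. *)
    have [meet|nmeet] := pselect (forall m, exists f, E m f /\ E n (g' - g + f)%R).
      have [m mE] := expansions_decided meet; left; apply: (FT _ _ m) => f Ef.
      exists (g' - g + f)%R; first exact: mE.
      by rewrite xg yg GRing.addrA (GRing.addrC g) GRing.subrK.
    have [m nm] : exists m, forall f, E m f -> ~ E n (g' - g + f)%R.
      apply: contrapT => nm; apply: nmeet => m; apply: contrapT => nf; apply: nm.
      by exists m => f Emf Enf; apply: nf; exists f.
    right; apply: (FT _ _ m) => f Ef [h Eh]; rewrite xg yg => /phi_inj ghf.
    apply: (nm _ Ef); suff -> : (g' - g + f = h)%R by [].
    by rewrite GRing.addrAC -ghf GRing.addrC GRing.addKr.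
- exists F; first by left.
  move=> A [n _ nA]; exists (phi @` E n.+1); first by exists n.+1.
  move=> _ _ [g Eg <-] [h Eh <-]; apply: nA; exists (g + h)%R.
    exact: expansionsD.
  by rewrite /phi -rees_classM.
- move=> s [n _ ns]; have [g Eg] := expansions_neq0 torsion unbounded n.
  have [m mE] := expansions_free torsion unbounded g.
  have [f Ef] := expansions_neq0 torsion unbounded (maxn n m).
  have Enf : E n f by apply: expansions_sub Ef; exact: leq_maxl.
  have /phi_inj fg : phi f = phi g.
    by apply: (etrans (ns _ _) (esym (ns _ _))); [exists f|exists g].
  by apply: mE; rewrite -fg; apply: expansions_sub Ef; exact: leq_maxr.
Qed.

End IdeallyClosedGroups.

(** * Chain-finite semigroups *)

Lemma dependent_choice_set (T : Type) (P : set T) (R : T -> T -> Prop) :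
  P !=set0 -> (forall x, P x -> exists2 y, P y & R x y) ->
  exists s : nat -> T, forall n, P (s n) /\ R (s n) (s n.+1).
Proof.
move=> [x0 Px0] next.
have /choice[f fP] : forall x : {x | P x}, exists y : {x | P x}, R (sval x) (sval y).
  by move=> [x Px]; have [y Py xy] := next x Px; exists (exist _ y Py).
pose s n := iter n f (exist _ x0 Px0).
by exists (fun n => sval (s n)) => n; split; [exact: (proj2_sig (s n))|exact: fP].
Qed.

Lemma maximal_exists (T : Type) (P : set T) (R : T -> T -> Prop) :
  (forall x y z, P x -> P y -> P z -> R x y -> R y z -> R x z) ->
  (forall x, P x -> ~ R x x) ->
  (forall C, C `<=` P -> (forall x y, C x -> C y -> [\/ x = y, R x y | R y x]) ->
     finite_set C) ->
  P !=set0 -> exists2 m, P m & forall x, P x -> ~ R m x.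
Proof.
move=> trR irrR fin P0; apply: contrapT => nmax.
have next x : P x -> exists2 y, P y & R x y.
  move=> Px; apply: contrapT => nx; apply: nmax; exists x => // y Py xy.
  by apply: nx; exists y.
have [s sP] := dependent_choice_set P0 next.
have Rs i j : i < j -> R (s i) (s j).
  elim: j => // j IH; rewrite ltnS leq_eqVlt => /predU1P[->|/IH ij].
    by case: (sP j).
  by apply: trR ij _; [case: (sP i)|case: (sP j)|case: (sP j.+1)|case: (sP j)].
have sinj : injective s.
  move=> i j sij; case: (ltngtP i j) => // /Rs; rewrite sij => /irrR H; exfalso.
    by apply: H; case: (sP j).
  by apply: H; case: (sP j).
apply: infinite_nat; rewrite -(eq_finite_set (inj_card_eq (in2W sinj))).
apply: fin => [_ [n _ <-]|_ _ [i _ <-] [j _ <-]]; first by case: (sP n).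
by case: (ltngtP i j) => [/Rs|/Rs|->]; [exact: Or32|exact: Or33|exact: Or31].
Qed.

Definition idempotents (S : semigroup) : set S := [set e | e ** e = e].

Definition chain_finite (S : semigroup) : Prop := forall C : set S,
  C `<=` @idempotents S ->
  (forall x y, C x -> C y -> x ** y = x \/ x ** y = y) -> finite_set C.

Section ChainFinite.
Variable S : semigroup.
Hypotheses (S_comm : forall x y : S, x ** y = y ** x) (S_chain : chain_finite S).

(** The order on idempotents is [x <= m] iff [x m = x]; a strictly descending sequence would be an
    infinite chain. *)
Lemma minimal_idempotent (P : set S) : P `<=` @idempotents S -> P !=set0 ->
  exists2 m, P m & forall x, P x -> x ** m = x -> x = m.
Proof.
move=> Pid P0.
have [] := @maximal_exists S P (fun x y => y <> x /\ y ** x = y) _ _ _ P0.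
- move=> x y z Px Py Pz [yx yxy] [zy zyz]; split; last by rewrite -zyz -sg_assoc yxy.
  by move=> zx; apply: yx; rewrite -yxy -zx S_comm.
- by move=> x _ [].
- move=> C CP Cch; apply: S_chain => [x /CP/Pid //|x y Cx Cy].
  have [->|[_ yx]|[_ xy]] := Cch _ _ Cx Cy.
  + by left; apply/Pid/CP.
  + by right; rewrite S_comm.
  + by left.
- move=> m Pm mmin; exists m => // x Px xm; apply: contrapT => nxm.
  exact: (mmin x Px).
Qed.

Lemma maximal_idempotent (P : set S) : P `<=` @idempotents S -> P !=set0 ->
  exists2 m, P m & forall x, P x -> m ** x = m -> x = m.
Proof.
move=> Pid P0.
have [] := @maximal_exists S P (fun x y => y <> x /\ x ** y = x) _ _ _ P0.
- move=> x y z Px Py Pz [yx xyx] [zy yzy]; split; last by rewrite -xyx -sg_assoc yzy.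
  by move=> zx; apply: zy; rewrite zx -yzy zx S_comm xyx.
- by move=> x _ [].
- move=> C CP Cch; apply: S_chain => [x /CP/Pid //|x y Cx Cy].
  have [->|[_ yx]|[_ xy]] := Cch _ _ Cx Cy.
  + by left; apply/Pid/CP.
  + by left.
  + by right; rewrite S_comm.
- move=> m Pm mmax; exists m => // x Px xm; apply: contrapT => nxm.
  exact: (mmax x Px).
Qed.

(** For a minimal [m] the product [m x] is an idempotent below [m], hence equal to [m]. *)
Lemma least_idempotent (e : S) : e ** e = e ->
  exists2 m : S, m ** m = m & forall x : S, x ** x = x -> m ** x = m.
Proof.
move=> ee; have [//||m mm mmin] := @minimal_idempotent (@idempotents S).
  by exists e.
rewrite /idempotents /= in mm; exists m => // x xx; rewrite S_comm; apply: mmin; last by rewrite -sg_assoc mm.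
by rewrite /idempotents /= -sg_assoc (S_comm m) -sg_assoc mm sg_assoc xx.
Qed.

(* A maximal idempotent with infinitely many elements of [P] above it has
   infinitely many minimal ones among them. *)
Lemma infinite_antichain (P : set S) : P `<=` @idempotents S -> infinite_set P ->
  exists A, [/\ A `<=` P, infinite_set A & forall x y, A x -> A y -> x ** y = x -> x = y].
Proof.
move=> Pid iP; pose up m := [set x | [/\ P x, m ** x = m & x <> m]].
have [e Pe] := infinite_setN0 iP.
have [m0 m00 m0le] := least_idempotent (Pid _ Pe).
have up0 : infinite_set (up m0).
  apply: sub_infinite_set (infinite_setD iP (finite_set1 m0)) => x [Px xm].
  by split => //; exact/m0le/Pid.
have [_ []//||m [mm iup] mmax] :=
  @maximal_idempotent [set m : S | m ** m = m /\ infinite_set (up m)].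
  by exists m0.
exists [set x | up m x /\ forall y, up m y -> y ** x = y -> y = x]; split.
- by move=> x [[]].
(* Each element of [up m] is above or equal to a minimal [a], and each [up a] is finite by
   maximality of [m]. *)
- move=> fA; apply: iup.
  apply: (@sub_finite_set _ _ (\bigcup_(a in [set x | up m x /\
      forall y, up m y -> y ** x = y -> y = x]) (a |` up a))).
    move=> x upx; have [y []||a [upa ax] amin] :=
        @minimal_idempotent [set y | up m y /\ y ** x = y].
      by move=> [/Pid].
    + by exists x; split => //; case: upx => /Pid.
    + exists a.
        split => // y upy ya; apply: amin => //; split => //.
        by rewrite -ya -sg_assoc ax.
      have [xa|xa] := pselect (x = a); [by left|right].
      by split => //; case: upx.
  apply: bigcup_finite => // a [upa _]; rewrite finite_setU; split => //.
  apply: contrapT => ia; case: (upa) => Pa ma; apply; apply: mmax => //.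
  by split => //; exact: Pid.
- by move=> x y [upx _] [_ ymin]; exact: ymin.
Qed.

End ChainFinite.

(** * Elements outside subgroups *)

Definition nil_at (X : semigroup) (e : X) : set X :=
  [set n | [/\ @ideal_center X n, exists2 k, 0 < k & pow n k = e & n ** e <> n]].

Section NilFinite.
Variables (X : semigroup) (X_closed : ideally_C_closed TzS X).
Variable e : X.
Hypotheses (eI : @ideal_center X e) (ee : e ** e = e).

Let N := nil_at e.
(** Besides the elements that do not divide [e], this ideal contains those fixed by [e], in
    particular the subgroup at [e]; the set [N] stays outside. *)
Let J := avoiding [set e] `|` [set x | x ** e = x].

Let JI : is_ideal J.
Proof.
move=> x y [Jy|ye].
  by split; left; [exact: (avoiding_ideal _ Jy).1|exact: (avoiding_ideal _ Jy).2].
split; right; first by rewrite /= -sg_assoc ye.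
by rewrite /= -sg_assoc (proj1 eI) sg_assoc ye.
Qed.

Let NnJ n : N n -> ~ J n.
Proof.
move=> [_ [k k0 nk] ne] [av|//]; apply: (av None (Some (pow n (k * 2).-1))) => /=.
have k2 : 0 < (k * 2).-1 by lia.
by rewrite -powS // prednK -?powM // ?nk ?pow_idem // muln_gt0 k0.
Qed.

(** If [x] divides [e], then [x e] lies in the subgroup at [e], so some power of [x n] equals
    [e]. *)
Let JN x n : N n -> J (x ** n) \/ N (x ** n).
Proof.
move=> [nI [k k0 nk] ne].
have [av|nav] := pselect (avoiding [set e] x).
  by left; left; exact: (avoiding_ideal n av).2.
have [xne|xne] := pselect (x ** n ** e = x ** n); first by left; right.
right; split => //; first exact: ideal_center_mull.
have [_ _ [l l0 xl]] := avoiding_subgroup X_closed eI ee nav.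
exists (l * k); first by rewrite muln_gt0 l0.
rewrite pow_mul; last exact: (proj1 nI).
have -> : pow n (l * k) = pow e (l * k) by rewrite mulnC -powM // nk !pow_idem.
rewrite -pow_mul; last exact: (proj1 eI).
by rewrite -powM // xl pow_idem.
Qed.

Let NJN x n : N n -> ~ J (x ** n) -> N (x ** n).
Proof. by move=> /(JN x)[]. Qed.

Let Nc n : N n -> @center X n.
Proof. by move=> [[]]. Qed.

Let multiples c := [set c ** n | n in N].

Let multiples_ideal c : @center X c -> is_ideal (J `|` multiples c).
Proof.
move=> cc x y [Jy|[n Nn <-{y}]].
  by split; left; [exact: (JI _ Jy).1|exact: (JI _ Jy).2].
have Jx : (J `|` multiples c) (x ** (c ** n)).
  rewrite sg_assoc cc -sg_assoc.
  by case: (JN x Nn) => xn; [left; exact: (JI c xn).1|right; exists (x ** n)].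
by split=> //; rewrite -(center_mul cc (Nc Nn)).
Qed.

(** Products of two multiples of [c] are multiples of [c c] or lie in [J]. So [multiples c] is null
    modulo the ideal they form, and only finitely many of its elements lie outside that ideal. *)
Let multiples_finite_sqr c : @center X c -> N c \/ J c ->
  finite_set (multiples (c ** c) `\` J) -> finite_set (multiples c `\` J).
Proof.
move=> cc [Nc'|Jc] fcc; last first.
  apply: (@sub_finite_set _ _ set0) => // _ [[n _ <-] []].
  exact: (JI _ Jc).2.
have fin : finite_set (multiples c `\` (J `|` multiples (c ** c))).
  apply: (null_mod_ideal_finite X_closed).
  - exact/multiples_ideal/center_mul.
  - by move=> _ [n Nn <-]; exact/center_mul/Nc.
  - move=> _ _ [n Nn <-] [m Nm <-].
    rewrite -sg_assoc (sg_assoc n) (cc n) -sg_assoc sg_assoc.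
    by case: (JN n Nm) => nm; [left; exact: (JI _ nm).1|right; exists (n ** m)].
apply: (@sub_finite_set _ _ ((multiples c `\` (J `|` multiples (c ** c))) `|`
    (multiples (c ** c) `\` J))); last by rewrite finite_setU.
move=> x [cx nJx]; have [ccx|nccx] := pselect (multiples (c ** c) x).
  by right.
by left; split => // -[].
Qed.

Let multiples_finite c : N c -> finite_set (multiples c `\` J).
Proof.
move=> Nc0; have [_ [k k0 ck] _] := Nc0.
(* As [2^k > k], this power is a multiple of [c^k = e]; repeated squaring therefore reaches [J]. *)
have : J (pow c (2 ^ k)).
  right=> /=; have kk : k < 2 ^ k := ltn_expl k (ltnSn 1).
  by rewrite -(subnKC (ltnW kk)) powD ?subn_gt0 // ck -(proj1 eI) -sg_assoc ee.
have : N c \/ J c by left.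
have := Nc Nc0; elim: (k) c {Nc0 ck} => [|j IH] c cc NJc Jc.
  apply: (@sub_finite_set _ _ set0) => // _ [[n _ <-] []].
  exact: (JI _ Jc).2.
apply: multiples_finite_sqr => //; apply: IH.
- exact: center_mul.
- by case: NJc => [/(JN c)[]|cJ]; [right|left|right; exact: (JI _ cJ).1].
- by move: Jc; rewrite expnS -powM ?expn_gt0 // powS.
Qed.

Let products := [set x | exists2 y, N y & multiples y x].

Let generators := N `\` (J `|` products).

(** The set [N] is null modulo the ideal formed by [J] and [products]. *)
Let generators_finite : finite_set generators.
Proof.
apply: (null_mod_ideal_finite X_closed); last 2 first.
- exact: Nc.
- move=> x y Nx Ny; have [|Nxy] := JN x Ny; first by left.
  by right; exists x => //; exists y.
move=> x y [Jy|[z Nz [n Nn zn]]].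
  by split; left; [exact: (JI _ Jy).1|exact: (JI _ Jy).2].
have : (J `|` multiples z) y by right; exists n.
move=> /(multiples_ideal (Nc Nz) x)[H1 H2].
by split; [case: H1|case: H2] => ?; (try by left); right; exists z.
Qed.

(* An element that is neither a generator nor a multiple of one has a factor of
   the same kind; iterating gives infinitely many multiples of a single element. *)
Theorem nil_at_finite : finite_set N.
Proof.
apply: (@sub_finite_set _ _
  (generators `|` \bigcup_(g in generators) (multiples g `\` J))); last first.
  rewrite finite_setU; split => //; apply: bigcup_finite => // g [Ng _].
  exact: multiples_finite.
move=> x Nx; apply: contrapT => nx.
pose M := [set y | [/\ N y, ~ generators y & forall g, generators g -> ~ multiples g y]].
have Mx : M x.
  split => // [gx|g gg gx]; first by apply: nx; left.
  by apply: nx; right; exists g => //; split => //; exact: NnJ.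
have factor y : M y -> exists2 z, M z & exists2 v, N v & y = z ** v.
  move=> [Ny ngy nmy].
  have : (J `|` products) y by apply: contrapT => nJy; apply: ngy.
  case=> [/(NnJ Ny)//|[z Nz [v Nv zv]]].
  exists z; last by exists v.
  split => // [gz|g gg [n Nn gn]]; first by apply: (nmy z) => //; exists v.
  apply: (nmy g) => //; exists (n ** v); last by rewrite sg_assoc gn.
  apply: NJN => // Jnv; apply: (NnJ Ny); rewrite -zv -gn -sg_assoc.
  exact: (JI _ Jnv).1.
(* These are the cofactors [w] in [x = y w] with [y] in [M]; factoring [y] further replaces [w] by
   some [v w]. *)
pose W := [set w | N w /\ exists2 y, M y & x = y ** w].
have Wnext w : W w -> exists2 v, N v & W (v ** w).
  move=> [Nw [y /factor[z Mz [v Nv yzv]] xyw]].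
  have xvw : x = z ** (v ** w) by rewrite sg_assoc -yzv.
  exists v => //; split; last by exists z.
  by apply: NJN => // Jvw; apply: (NnJ Nx); rewrite xvw; exact: (JI _ Jvw).1.
have [z Mz [w0 Nw0 xzw]] := factor x Mx.
have Ww0 : W w0 by split => //; exists z.
pose W' := W `&` (w0 |` multiples w0).
have W'_finite : finite_set W'.
  apply: (@sub_finite_set _ _ (w0 |` (multiples w0 `\` J))).
    by move=> w [[Nw _] [->|w0w]]; [left|right; split => //; exact: NnJ].
  by rewrite finite_setU; split => //; exact: multiples_finite.
have [] := @maximal_exists X W' (fun w w' => exists2 v, N v & w' = v ** w).
- move=> u v w _ _ [[Nw _] _] [a Na ->] [b Nb wE]; exists (b ** a); last by rewrite wE sg_assoc.
  apply: NJN => // Jba; apply: (NnJ Nw); rewrite wE sg_assoc.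
  exact: (JI _ Jba).2.
(* From [w = v w] follows [w = v^k w = e w], which lies in [J]. *)
- move=> w [[Nw _] _] [v Nv wvw]; apply: (NnJ Nw).
  have [_ [k k0 vk] _] := Nv.
  have -> : w = pow v k ** w.
    case: k k0 {vk} => // k _; elim: k => [//|k IH].
    by rewrite powS // -sg_assoc -IH.
  by rewrite vk; apply: (JI w _).2; right.
- by move=> C CW' _; exact: sub_finite_set W'_finite.
- by exists w0; split => //; left.
- move=> w [Ww w0w] wmax; have [v Nv Wvw] := Wnext w Ww.
  apply: (wmax (v ** w)); last by exists v.
  split => //; right; case: w0w => [->|[n Nn w0n]].
    by exists v => //; rewrite (Nc Nv).
  exists (v ** n); last by rewrite sg_assoc (Nc Nv) -sg_assoc w0n.
  apply: NJN => // Jvn; case: Wvw => Nvw _; apply: (NnJ Nvw).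
  rewrite -w0n sg_assoc (Nc Nw0) -sg_assoc; exact: (JI _ Jvn).1.
Qed.

End NilFinite.

Lemma idempotent_pow_unique (S : semigroup) (x e f : S) k l :
  e ** e = e -> f ** f = f -> 0 < k -> 0 < l -> pow x k = e -> pow x l = f -> e = f.
Proof.
move=> ee ff k0 l0 xk xl.
by rewrite -(pow_idem l ee) -xk powM // mulnC -powM // xl pow_idem.
Qed.

(** Take the power [n^(j-1)] for the least [j] with [n^j e = n^j]; here [j >= 2], so the exponent
    [2 (j - 1)] of its square is at least [j]. *)
Lemma nil_at_null_square (X : semigroup) (e : X) :
  @center X e -> e ** e = e -> nil_at e !=set0 ->
  exists2 x, nil_at e x & x ** x ** e = x ** x.
Proof.
move=> ec ee [n [nI [k k0 nk] ne]].
have up i j : 0 < i <= j -> pow n i ** e = pow n i -> pow n j ** e = pow n j.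
  move=> /andP[i0]; rewrite leq_eqVlt => /predU1P[<-//|ij] nie.
  have d0 : 0 < j - i by rewrite subn_gt0.
  by rewrite -(subnK (ltnW ij)) powD // -sg_assoc nie.
have exj : exists j, (0 < j) && `[< pow n j ** e = pow n j >].
  by exists k; rewrite k0; apply/asboolP; rewrite nk.
case: (ex_minnP exj) => j /andP[j0 /asboolP nje] jmin.
have j1 : 1 < j.
  by rewrite ltn_neqAle j0 andbT; apply/eqP => j1; apply: ne; rewrite -j1 in nje.
have jp : 0 < j.-1 by rewrite -ltnS prednK.
exists (pow n j.-1); last first.
  rewrite -powD //; apply: up nje; rewrite j0; lia.
split.
- exact: ideal_center_pow.
- by exists k => //; rewrite powM // mulnC -powM // nk pow_idem.
- move=> nje'; have := jmin j.-1; rewrite jp /=.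
  by move/(_ (asboolT nje')); lia.
Qed.

(** * The four finiteness properties of the ideal center *)

Section IdealCenterStructure.
Variables (X : semigroup) (X_closed : ideally_C_closed TzS X).
Local Notation Z := (ideal_center_semigroup X).

Lemma ideal_center_inj (x y : Z) : sval x = sval y -> x = y.
Proof. by move=> xy; apply: eq_sig_hprop => // ? ? ?; exact: Prop_irrelevance. Qed.

Lemma sval_pow (x : Z) n : sval (pow x n) = pow (sval x) n.
Proof. exact: (pow_hom (f := fun z : Z => sval z)). Qed.

Lemma ideal_center_comm (x y : Z) : x ** y = y ** x.
Proof. by apply: ideal_center_inj; exact: (proj1 (proj2_sig y)). Qed.

Lemma ideal_center_periodic (x : Z) :
  exists2 k, 0 < k & pow x k ** pow x k = pow x k.
Proof.
have [k k0 xk] := ideally_closed_periodic X_closed (proj1 (proj2_sig x)).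
by exists k => //; apply: ideal_center_inj; rewrite /= sval_pow.
Qed.

Lemma ideal_center_chain_finite : chain_finite Z.
Proof.
move=> C Cid Cch.
have inj : {in C &, injective (fun z : Z => sval z)}.
  by move=> x y _ _; exact: ideal_center_inj.
rewrite -(eq_finite_set (inj_card_eq inj)).
apply: central_chain_finite (ideally_closed_closed X_closed) _ _.
  by move=> _ [x _ <-]; exact: (proj1 (proj2_sig x)).
move=> _ _ [x Cx <-] [y Cy <-].
by have [xy|xy] := Cch x y Cx Cy; [left|right]; rewrite -[in RHS]xy.
Qed.

Lemma ideal_center_bounded (e : Z) : e ** e = e -> exists2 N, 0 < N &
  forall h k, h ** e = h -> 0 < k -> pow h k = e -> pow h N = e.
Proof.
move=> /(congr1 sval) ee.
have [N N0 NP] := subgroup_at_bounded X_closed (proj2_sig e) ee.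
exists N => // h k he k0 hk; apply: ideal_center_inj; rewrite sval_pow; apply: NP.
split; first exact: (proj2_sig h).
  by rewrite -[in RHS]he.
by exists k => //; rewrite -hk sval_pow.
Qed.

(** Over an infinite antichain [A] of such idempotents choose elements [c e] whose squares are fixed
    by [e]. They form a null set modulo the largest ideal avoiding them all, so there are finitely
    many. *)
Lemma nil_idempotents_finite :
  finite_set [set e : Z | e ** e = e /\ nil_at (sval e) !=set0].
Proof.
apply: contrapT => iP.
have [A [AP iA anti]] : exists A, [/\ A `<=` [set e : Z | e ** e = e /\
    nil_at (sval e) !=set0], infinite_set A &
    forall x y : Z, A x -> A y -> x ** y = x -> x = y].
  apply: infinite_antichain iP; first exact: ideal_center_comm.
    exact: ideal_center_chain_finite.
  by move=> e [].
have Aid e : A e -> sval e ** sval e = sval e by move=> /AP[/(congr1 sval)].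
have /choice[c cP] : forall e : Z, exists x, A e ->
    nil_at (sval e) x /\ x ** x ** sval e = x ** x.
  move=> e; have [Ae|nAe] := pselect (A e); last by exists (sval e).
  have [x xe xx] := nil_at_null_square (proj1 (proj2_sig e)) (Aid e Ae) (AP e Ae).2.
  by exists x.
have c_pow e : A e -> exists2 k, 0 < k & pow (c e) k = sval e.
  by move=> Ae; have [[_ [k k0 ck] _] _] := cP e Ae; exists k.
have c_center e : A e -> @center X (c e) by move=> Ae; have [[[]]] := cP e Ae.
have c_inj : {in A &, injective c}.
  move=> e f; rewrite !inE => Ae Af cef; apply: ideal_center_inj.
  have [k k0 ek] := c_pow e Ae; have [l l0 fl] := c_pow f Af.
  rewrite -cef in fl.
  exact: (idempotent_pow_unique (Aid e Ae) (Aid f Af) k0 l0 ek fl).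
apply: iA; rewrite -(eq_finite_set (inj_card_eq c_inj)).
have -> : c @` A = (c @` A) `\` avoiding (c @` A).
  apply/seteqP; split => [x cx|x []//]; split => // av; exact: (av None None).
apply: (@null_mod_ideal_finite X X_closed _ (c @` A) (avoiding_ideal (A := c @` A))).
  by move=> _ [e Ae <-]; exact: c_center.
move=> _ _ [e1 A1 <-] [e2 A2 <-] p q [g Ag cg].
have wc : @center X (c e1 ** c e2) by apply: center_mul; exact: c_center.
have [k1 k10 ck1] := c_pow e1 A1; have [k2 k20 ck2] := c_pow e2 A2.
have [k k0 ck] := c_pow g Ag.
pose K := k1 * k2 * k; have K0 : 0 < K by rewrite !muln_gt0 k10 k20 k0.
have wK : pow (c e1 ** c e2) K = sval e1 ** sval e2.
  rewrite pow_mul; last exact: c_center.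
  have -> : pow (c e1) K = sval e1.
    by rewrite /K -mulnA -powM ?muln_gt0 ?k20 // ck1 pow_idem // Aid.
  have -> : pow (c e2) K = sval e2.
    by rewrite /K [k1 * k2]mulnC -mulnA -powM ?muln_gt0 ?k10 // ck2 pow_idem // Aid.
  by [].
have cgE : c g = rmul1 (c e1 ** c e2) (mul1 p q).
  by rewrite cg; case: (p) (q) => [p'|] [q'|] //=; rewrite wc sg_assoc.
(* Raising [c g = p (c e1) (c e2) q] to the common power [K] puts [g] below [e1] and [e2], hence
   [g = e1 = e2] in the antichain. Then [c g] is a multiple of its own square and so fixed by [g],
   which is excluded. *)
have [r gr] : exists r, sval g = rmul1 (sval e1 ** sval e2) r.
  have -> : sval g = pow (c g) K.
    by rewrite /K mulnC -powM ?muln_gt0 ?k10 // ck pow_idem // Aid.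
  rewrite cgE; case: (mul1 p q) => [s|] /=; last by exists None; rewrite wK.
  by exists (Some (pow s K)); rewrite pow_mul ?wK //= -wc.
have e1c : @center X (sval e1) by exact: (proj1 (proj2_sig e1)).
have e2c : @center X (sval e2) by exact: (proj1 (proj2_sig e2)).
have rmul1c (x y : X) s : x ** y = y -> x ** rmul1 y s = rmul1 y s.
  by rewrite -rmul1A => ->.
have g1 : g = e1.
  apply: anti => //; apply: ideal_center_inj; rewrite /= e1c gr; apply: rmul1c.
  by rewrite sg_assoc Aid.
have g2 : g = e2.
  apply: anti => //; apply: ideal_center_inj; rewrite /= e2c gr; apply: rmul1c.
  by rewrite (e2c (sval e1)) sg_assoc Aid.
have gc : @center X (sval g) by exact: (proj1 (proj2_sig g)).
have [[_ _ cgg] cg2] := cP g Ag; apply: cgg.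
by rewrite gc cgE -g1 -g2; apply: rmul1c; rewrite -gc cg2.
Qed.

(** In a periodic semigroup these are the elements outside all subgroups; the idempotent [x^k] does
    not depend on [k]. *)
Definition nonregular (S : semigroup) : set S := [set x | exists k,
  [/\ 0 < k, pow x k ** pow x k = pow x k & x ** pow x k <> x]].

Lemma ideal_center_nonregular_finite : finite_set (@nonregular Z).
Proof.
have inj : {in @nonregular Z &, injective (fun z : Z => sval z)}.
  by move=> x y _ _; exact: ideal_center_inj.
rewrite -(eq_finite_set (inj_card_eq inj)).
apply: (@sub_finite_set _ _ (\bigcup_(e in [set e : Z | e ** e = e /\
    nil_at (sval e) !=set0]) nil_at (sval e))).
  move=> _ [x [k [k0 kk xk]] <-].
  have xn : nil_at (sval (pow x k)) (sval x).
    split; first exact: (proj2_sig x).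
      by exists k => //; rewrite sval_pow.
    by move=> E; apply: xk; exact: ideal_center_inj.
  by exists (pow x k) => //; split => //; exists (sval x).
apply: bigcup_finite nil_idempotents_finite _ => e [/(congr1 sval) ee _].
exact: (nil_at_finite X_closed (proj2_sig e) ee).
Qed.

End IdealCenterStructure.

(** * Closedness in T1 topological semigroups *)

Section ClosedImage.
Variable S : semigroup.
Hypotheses (S_comm : forall x y : S, x ** y = y ** x) (S_chain : chain_finite S).
Hypothesis S_periodic :
  forall x : S, exists2 k, 0 < k & pow x k ** pow x k = pow x k.
Hypothesis S_bounded : forall e : S, e ** e = e -> exists2 N, 0 < N &
  forall h k, h ** e = h -> 0 < k -> pow h k = e -> pow h N = e.
Hypothesis S_nonregular : finite_set (@nonregular S).

Let per (x : S) : nat := s2val (cid2 (S_periodic x)).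

Let per_gt0 x : 0 < per x.
Proof. exact: (s2valP (cid2 (S_periodic x))). Qed.

Let idp (x : S) : S := pow x (per x).

Let idp_idem x : idp x ** idp x = idp x.
Proof. exact: (s2valP' (cid2 (S_periodic x))). Qed.

Let regular_idp x : ~ nonregular x -> x ** idp x = x.
Proof.
move=> rx; apply: contrapT => nx; apply: rx; exists (per x).
by split; [exact: per_gt0|exact: idp_idem|].
Qed.

Let idp_unique x e k : 0 < k -> e ** e = e -> pow x k = e -> idp x = e.
Proof.
move=> k0 ee xk.
exact: (idempotent_pow_unique (idp_idem x) ee (per_gt0 x) k0 erefl xk).
Qed.

Let idpM x y : idp (x ** y) = idp x ** idp y.
Proof.
apply: (@idp_unique _ _ (per x * per y)); first by rewrite muln_gt0 !per_gt0.
  rewrite -sg_assoc (sg_assoc (idp y)) (S_comm (idp y)) -sg_assoc idp_idem.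
  by rewrite sg_assoc idp_idem.
rewrite pow_mul // -powM // -/(idp x) mulnC -powM // -/(idp y).
by rewrite !pow_idem.
Qed.

Variables (Y : topologicalType) (m : Y -> Y -> Y) (phi : S -> Y).
Hypotheses (mA : forall x y z, m x (m y z) = m (m x y) z)
  (m_cont : continuous (fun p : Y * Y => m p.1 p.2)) (Y_T1 : accessible_space Y).
Hypothesis phiM : forall x y, phi (x ** y) = m (phi x) (phi y).
Hypothesis phi_discrete : forall s, exists U : set Y,
  [/\ open U, U (phi s) & forall t, U (phi t) -> phi t = phi s].

Let YS : semigroup := @Defs.Semigroup Y m mA.

Let mpow (v : Y) n : Y := pow (v : YS) n.

Let phi_pow x n : phi (pow x n) = mpow (phi x) n.
Proof. exact: (@pow_hom S YS phi). Qed.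

Let m_continuous (f g : Y -> Y) : continuous f -> continuous g ->
  continuous (fun v => m (f v) (g v)).
Proof.
move=> cf cg v.
apply: (@cvg_comp _ _ _ (fun v => (f v, g v)) (fun p => m p.1 p.2) _ (nbhs (f v, g v))).
  by apply: cvg_pair; [exact: cf|exact: cg].
exact: (@m_cont (f v, g v)).
Qed.

Let mpow_continuous n (f : Y -> Y) : continuous f -> continuous (fun v => mpow (f v) n).
Proof.
by case: n => [//|n] cf; elim: n => [//|n IH]; exact: m_continuous.
Qed.

Let id_continuous : continuous (fun v : Y => v).
Proof. by move=> v; exact: cvg_id. Qed.

Let cst_continuous' (c : Y) : continuous (fun _ : Y => c).
Proof. by move=> v; exact: cvg_cst. Qed.

Let near_neq (f : Y -> Y) (y c : Y) : continuous f -> f y <> c ->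
  \forall v \near y, f v <> c.
Proof.
move=> cf fyc; have oc : open (~` [set c]).
  exact/closed_openC/accessible_closed_set1.
have fy : nbhs (f y) (~` [set c]) by exact: open_nbhs_nbhs.
exact: (cf y _ fy).
Qed.

Let phi_idem (e : S) : e ** e = e -> sg_op (phi e : YS) (phi e) = phi e.
Proof. by move=> ee; rewrite -[in RHS]ee phiM. Qed.

Let phi_idp w e k : e ** e = e -> 0 < k -> mpow (phi w) k = phi e ->
  phi (idp w) = phi e.
Proof.
move=> ee k0 wk.
apply: (@idempotent_pow_unique YS (phi w) _ _ (per w) k) => //.
- exact: phi_idem.
- exact: phi_idem.
- by rewrite phi_pow.
Qed.

Let common_period : exists2 M, 0 < M & forall w, nonregular w -> per w %| M.
Proof.
have /finite_seqP[s sP] : finite_set (per @` @nonregular S) by exact: finite_image.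
have s0 i : i \in s -> 0 < i.
  by move=> si; have [x _ <-] : (per @` @nonregular S) i by rewrite sP.
exists (\prod_(i <- s | 0 < i) i); first exact: prodn_cond_gt0.
move=> w nw; have ws : per w \in s.
  by have : (per @` @nonregular S) (per w) by [exists w]; rewrite sP.
by rewrite (big_rem _ ws) /= per_gt0 dvdn_mulr.
Qed.

(** Since [phi] may identify idempotents, pass to the least [e0] with the image of [e]. A regular
    [w] has the same image as [w e0], which lies in the subgroup at [e0]; the periods of the
    nonregular elements divide [M]. *)
Let image_bounded e : e ** e = e -> exists2 N, 0 < N &
  forall w k, 0 < k -> mpow (phi w) k = phi e -> mpow (phi w) N = phi e.
Proof.
move=> ee.
have [|| e0 [e00 e0e] e0min] :=
    @minimal_idempotent S S_comm S_chain [set f : S | f ** f = f /\ phi f = phi e].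
- by move=> f [].
- by exists e.
have e0le f : f ** f = f -> phi f = phi e -> f ** e0 = e0.
  move=> ff fe; apply: e0min; last by rewrite -sg_assoc e00.
  split; last by rewrite phiM fe e0e -phiM ee.
  by rewrite -sg_assoc (sg_assoc e0) (S_comm e0) -sg_assoc e00 sg_assoc ff.
have [n n0 nP] := S_bounded e00; have [M M0 MP] := common_period.
exists (n * M); first by rewrite muln_gt0 n0.
move=> w k k0 wk; have fe := phi_idp ee k0 wk.
have [nw|rw] := pselect (nonregular w).
  have [l lE] : exists l, n * M = per w * l.
    by have /dvdnP[l ->] := MP w nw; exists (n * l); rewrite mulnA mulnC.
  have l0 : 0 < l by move: M0 n0; case: l lE => //; lia.
  by rewrite -phi_pow lE -powM // -/(idp w) pow_idem.
have wf := regular_idp rw.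
have we0 : pow (w ** e0) n = e0.
  apply: (nP _ (per w)) => //; first by rewrite -sg_assoc e00.
  by rewrite pow_mul // (pow_idem _ e00) -/(idp w) e0le.
have -> : phi w = phi (w ** e0) by rewrite phiM e0e -fe -phiM wf.
by rewrite -phi_pow -powM // we0 pow_idem.
Qed.

Section LimitPoint.
Variable y : Y.
Hypotheses (y_closure : closure (range phi) y) (y_notin : ~ range phi y).

Let near_phi (U : set Y) : nbhs y U -> exists u, U (phi u).
Proof. by move=> /y_closure[_ [[u _ <-] Uu]]; exists u. Qed.

(** If [y^N = phi e], discreteness gives [phi (u t^n) = phi e] for [u], [t] near [y], and
    [phi (u e)] becomes constant. It equals [phi u] for regular [u], so the image near [y] is
    finite, and T1 would put [y] into it. *)
Let mpow_neq e N : e ** e = e -> 0 < N -> mpow y N <> phi e.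
Proof.
move=> ee N0 yN; have [V [oV Ve Vdisc]] := phi_discrete e.
(* This [n] is positive even for [N = 1], and [n + 1] is still a multiple of [N]. *)
pose n := N * 2 - 1; have n0 : 0 < n by rewrite /n; lia.
have yn : m y (mpow y n) = phi e.
  rewrite /mpow -[LHS]/(sg_op (y : YS) (pow (y : YS) n)) -powS //.
  have -> : n.+1 = N * 2 by rewrite /n; lia.
  by rewrite -powM // -/(mpow y N) yN pow_idem //; exact: phi_idem.
have [[U1 U2] [/= U1y U2y] UV] : nbhs (y, y) [set p : Y * Y | V (m p.1 (mpow p.2 n))].
  have cont : continuous (fun p : Y * Y => m p.1 (mpow p.2 n)).
    move=> [v w].
    apply: (@cvg_comp _ _ _ (fun p : Y * Y => (p.1, mpow p.2 n)) (fun p => m p.1 p.2)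
      _ (nbhs (v, mpow w n))); last exact: (@m_cont (v, mpow w n)).
    apply: cvg_pair; first exact: cvg_fst.
    apply: (@cvg_comp _ _ _ snd (fun v => mpow v n) _ (nbhs w)); first exact: cvg_snd.
    exact: mpow_continuous.
  by apply: (cont (y, y)); apply: open_nbhs_nbhs; split => //=; rewrite yn.
have Uy : nbhs y (U1 `&` U2) by exact: filterI.
have mul u t : (U1 `&` U2) (phi u) -> (U1 `&` U2) (phi t) -> phi (u ** pow t n) = phi e.
  move=> [uU _] [_ tU]; apply: Vdisc; rewrite phiM phi_pow.
  exact: (UV (phi u, phi t)).
have [t Ut] := near_phi Uy.
have const u : (U1 `&` U2) (phi u) -> phi (u ** e) = phi (t ** e).
  move=> Uu.
  have -> : phi (u ** e) = phi (u ** (t ** pow t n)) by rewrite !(phiM u) (mul t t Ut Ut).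
  by rewrite (S_comm t) sg_assoc phiM (mul u t Uu Ut) -phiM S_comm.
have fK : finite_set (phi (t ** e) |` (phi @` @nonregular S)).
  by rewrite finite_setU; split => //; exact: finite_image.
have oK : open (~` (phi (t ** e) |` (phi @` @nonregular S))).
  by apply: closed_openC; apply: (proj1 accessible_finite_set_closed).
have [u [Uu]] : exists u, ((U1 `&` U2) `&` ~` (phi (t ** e) |` (phi @` @nonregular S))) (phi u).
  apply: near_phi; apply: filterI => //; apply: open_nbhs_nbhs; split => //.
  by move=> [yt|[w _ wy]]; apply: y_notin; [exists (t ** e)|exists w].
apply; have [nu|ru] := pselect (nonregular u); first by right; exists u.
left; have uf := regular_idp ru.
have fe : phi (idp u) = phi e.
  apply: (@phi_idp _ _ n.+1) => //.
  by rewrite -phi_pow powS //; exact: mul.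
by rewrite /= -(const u Uu) phiM -fe -phiM uf.
Qed.

(** Squaring [u] does not change the idempotent power of [l u]. So [L (y y)^N = phi e] would force
    [L (phi u)^N = phi e] for [u] near [y], while [L v^N] differs from [phi e] for all [v] near
    [y]. *)
Let mul_square_neq e N (L : Y -> Y) (l : S -> S) : e ** e = e -> 0 < N ->
  (forall w k, 0 < k -> mpow (phi w) k = phi e -> mpow (phi w) N = phi e) ->
  continuous L -> (forall u, L (phi u) = phi (l u)) ->
  (forall u, idp (l (u ** u)) = idp (l u)) ->
  mpow (L y) N <> phi e -> mpow (L (m y y)) N <> phi e.
Proof.
move=> ee N0 NP cL Ll ll Ly Lyy; have [V [oV Ve Vdisc]] := phi_discrete e.
have near1 : \forall v \near y, V (mpow (L (m v v)) N).
  have cont : continuous (fun v => mpow (L (m v v)) N).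
    apply: mpow_continuous => v.
    apply: (@cvg_comp _ _ _ (fun v => m v v) L _ (nbhs (m v v))); last exact: cL.
    exact: (m_continuous id_continuous id_continuous).
  by apply: cont; apply: open_nbhs_nbhs; rewrite Lyy.
have near2 := near_neq (mpow_continuous (n := N) cL) Ly.
have [u [Vu]] := near_phi (filterI near1 near2); apply.
rewrite /= -phiM Ll -phi_pow in Vu; have := Vdisc _ Vu.
rewrite phi_pow => /(phi_idp ee N0); rewrite ll Ll => lue.
by apply: (NP _ (per (l u))) => //; rewrite -phi_pow.
Qed.

Lemma limit_point_absurd : False.
Proof.
have [u0 _] := near_phi (filterT : nbhs y setT).
have [e0 e00 e0le] := least_idempotent S_comm S_chain (idp_idem u0).
have [|| e [ee [U0 U0y U0e]] emax] := @maximal_idempotent S S_comm S_chain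
    [set e : S | e ** e = e /\
       exists2 U, nbhs y U & forall u, U (phi u) -> idp u ** e = e].
- by move=> e [].
- exists e0; split => //; exists setT; first exact: filterT.
  by move=> u _; rewrite S_comm e0le.
have [N N0 NP] := image_bounded ee.
have y1 := mpow_neq ee N0.
have neq_near (L : Y -> Y) (l : S -> S) : continuous L ->
    (forall u, L (phi u) = phi (l u)) -> (forall u, idp (l (u ** u)) = idp (l u)) ->
    (forall v w, L (m v w) = m (L v) w) ->
    mpow (L y) N <> phi e -> \forall v \near y,
      [/\ U0 v, mpow (L v) N <> phi e & mpow (m (L v) y) N <> phi e].
  move=> cL Ll ll LM Ly; have Lyy := mul_square_neq ee N0 NP cL Ll ll Ly.
  rewrite LM in Lyy.
  have n1 := near_neq (mpow_continuous (n := N) cL) Ly.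
  have n2 := near_neq (mpow_continuous (n := N)
    (m_continuous cL (cst_continuous' (c := y)))) Lyy.
  by apply: filterS (filterI U0y (filterI n1 n2)) => v [? [? ?]].
(* Among products [w] of elements near [y], take one with minimal idempotent power [g]; the
   condition on [phi w y] is what permits multiplying by one more factor near [y]. *)
have [|| g [gg [w [wg we w1 w2]]] gmin] := @minimal_idempotent S S_comm S_chain
    [set g : S | g ** g = g /\ exists w, [/\ idp w = g, g ** e = e,
       mpow (phi w) N <> phi e & mpow (m (phi w) y) N <> phi e]].
- by move=> g [].
- have [||||u [U0u u1 u2]] := near_phi (neq_near id id _ _ _ _ y1) => //.
    by move=> u; rewrite /= idpM idp_idem.
  by exists (idp u); split; [exact: idp_idem|exists u; split => //; exact: U0e].
have ge : g <> e.
  move=> ge; apply: w1; apply: (NP _ (per w)) => //.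
  by rewrite -phi_pow -/(idp w) wg ge.
have nbad := neq_near (fun v => m (phi w) v) (fun u => w ** u).
have {}nbad : \forall v \near y, [/\ U0 v, mpow (m (phi w) v) N <> phi e &
    mpow (m (m (phi w) v) y) N <> phi e].
  apply: nbad => //.
  - exact: (m_continuous (cst_continuous' (c := phi w)) id_continuous).
  - by move=> u; rewrite !idpM idp_idem.
(* If [idp u] were above [g] for all [u] near [y], maximality of [e] would give [g = e], against
   [ge]. *)
have [u [Uu ug]] : exists u, [/\ U0 (phi u), mpow (m (phi w) (phi u)) N <> phi e &
    mpow (m (m (phi w) (phi u)) y) N <> phi e] /\ idp u ** g <> g.
  apply: contrapT => nu; apply: ge; apply: emax; last by rewrite S_comm.
  split => //; exists [set v | [/\ U0 v, mpow (m (phi w) v) N <> phi e &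
    mpow (m (m (phi w) v) y) N <> phi e]] => // u Uu.
  by apply: contrapT => ug; apply: nu; exists u.
case: Uu => U0u wu1 wu2; apply: ug.
(* The product [w u] competes with [w], and [idp (w u)] is below [g], so minimality makes them
   equal; this puts [idp u] above [g]. *)
suff E : idp (w ** u) = g by rewrite S_comm -wg -idpM E wg.
apply: gmin; last first.
  by rewrite idpM wg -sg_assoc (S_comm _ g) sg_assoc gg.
split; first exact: idp_idem.
exists (w ** u); split => //; rewrite ?phiM //.
by rewrite idpM wg -sg_assoc U0e.
Qed.

End LimitPoint.

Theorem closed_image : closed (range phi).
Proof. by move=> y yc; apply: contrapT => /(limit_point_absurd yc). Qed.

End ClosedImage.

Theorem theorem1p14 (X : semigroup) :
  ideally_C_closed TzS X ->
  projectively_C_closed T1S (ideal_center_semigroup X).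
Proof.
move=> XC r Y m [[mA m_cont] Y_T1] h [h_inj hM h_disc].
(* The embedding of the quotient is traded for a homomorphism from the ideal center itself, where
   the four properties are known. *)
have -> : range h = range (fun z => h (qclass r z)).
  apply/seteqP; split => _ [x _ <-]; last by exists (qclass r x).
  by exists (qrep x); rewrite ?qclass_qrep.
apply: (closed_image (@ideal_center_comm X) (ideal_center_chain_finite XC)
  (ideal_center_periodic XC) (ideal_center_bounded XC)
  (ideal_center_nonregular_finite XC) mA m_cont Y_T1).
- by move=> x y; rewrite qclassM hM.
- move=> x; have [U [oU Ux Uinj]] := h_disc (qclass r x).
  by exists U; split => // t /Uinj ->.
Qed.
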